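(* Let $E$ be a real topological vector space and let $(s_n)_{n\in\mathbb{N}}$ and $(r_n)_{n\in\mathbb{N}}$ be sequences of positive reals such that $\sum_{n=1}^\infty s_n<\infty$ and $r_n\geq s_n+\frac{2}{n^2}$ for each $n\in\mathbb{N}$. Furthermore, let $(\gamma_n)_{n\in\mathbb{N}}$ be a sequence of smooth maps $\gamma_n:[-r_n,r_n]\to E$ which become small sufficiently fast in the sense that, for each gauge $q$ on $E$, there exists a calibration $(q_n)_{n\in\mathbb{N}_0}$ on $E$ extending $q$ (i.e. $q_0=q$) such that $$(\forall k,\ell,m\in\mathbb{N}_0)\quad \lim_{n\to\infty} n^\ell\,\|\gamma_n^{<k>}\|_{q_{n+m},\infty}=0 .$$ Then there exists a curve $\gamma\in BC^\infty(\mathbb{R},E)$ with $\operatorname{im}(\gamma)\subseteq[0,1]\cdot\bigcup_{n\in\mathbb{N}}\operatorname{im}(\gamma_n)$ and a convergent sequence $(t_n)_{n\in\mathbb{N}}$ of real numbers such that $$\gamma(t_n+t)=\gamma_n(t)\quad\text{for all } n\in\mathbb{N}\text{ and } t\in[-s_n,s_n].$$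
   Context: Conventions: $\mathbb{N}=\{1,2,\ldots\}$, $\mathbb{N}_0=\mathbb{N}\cup\{0\}$. All topological vector spaces are assumed Hausdorff (no local convexity or completeness is assumed). For $S\subseteq E$, $[0,1]\cdot S=\{tx: t\in[0,1],\,x\in S\}$. $C^k$-maps (here with $\mathbb{K}=\mathbb{R}$): Let $U\subseteq\mathbb{R}$ be a non-empty subset without isolated points and $\gamma:U\to E$ a map. $\gamma$ is $C^0$ if it is continuous; then $\gamma^{<0>}:=\gamma$. Recursively, for $k\geq 1$, $\gamma$ is $C^k$ if it is $C^{k-1}$ and there is a (necessarily unique) continuous map $\gamma^{<k>}:U^{k+1}\to E$ such that $$\gamma^{<k>}(x_0,\ldots,x_k)=\frac{\gamma^{<k-1>}(x_k,x_1,\ldots,x_{k-1})-\gamma^{<k-1>}(x_0,x_1,\ldots,x_{k-1})}{x_k-x_0}$$ for all $(x_0,\ldots,x_k)\in U^{k+1}$ with $x_0\neq x_k$. $\gamma$ is $C^\infty$ (smooth) if it is $C^k$ for all $k\in\mathbb{N}_0$. A subset $A\subseteq E$ is bounded if for each $0$-neighbourhood $W\subseteq E$ there is a $0$-neighbourhood $V\subseteq\mathbb{R}$ with $VA\subseteq W$. $BC^\infty(U,E)$ is the space of all $C^\infty$-maps $\gamma:U\to E$ such that $\gamma^{<j>}$ has bounded image for each $j\in\mathbb{N}_0$. A gauge on $E$ is a map $q:E\to[0,\infty[$ such that $q(tx)=|t|q(x)$ for all $t\in\mathbb{R}$, $x\in E$, and $q^{-1}([0,r[)$ is a $0$-neighbourhood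 in $E$ for each $r>0$. A calibration on $E$ is a sequence $(q_n)_{n\in\mathbb{N}_0}$ of gauges on $E$ such that $q_n(x+y)\leq q_{n+1}(x)+q_{n+1}(y)$ for all $n\in\mathbb{N}_0$ and $x,y\in E$. For a gauge $q$ on $E$ and a $C^k$-map $\gamma:U\to E$, $\|\gamma^{<k>}\|_{q,\infty}:=\sup\{q(\gamma^{<k>}(x)): x\in U^{k+1}\}$. *)

(* Defs.v *)
From HB Require Import structures.
From mathcomp Require Import all_boot all_order all_algebra.
From mathcomp Require Import all_classical all_reals all_analysis.
Set Implicit Arguments.
Unset Strict Implicit.
Unset Printing Implicit Defensive.
Import Order.TTheory GRing.Theory Num.Theory.
Import numFieldNormedType.Exports.
Local Open Scope classical_set_scope.
Local Open Scope ring_scope.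

Section Curves.
Context {R : realType} {E : topologicalLmodType R}.
Implicit Types (U : set R) (c : R -> E) (k : nat) (q : E -> R).

(* A map defined on a set [U] of reals is represented by a total function
   [c : R -> E]; its values outside [U] play no role.  Likewise for maps
   defined on [U ^ n]. *)
Definition setpow U n : set 'rV[R]_n := [set x | forall i, U (x ord0 i)].

(* From (x_0, ..., x_(k+1)): (x_0, x_1, ..., x_k). *)
Definition drop_last k (x : 'rV[R]_k.+2) : 'rV[R]_k.+1 :=
  \row_(j < k.+1) x ord0 (widen_ord (leqnSn k.+1) j).

(* From (x_0, ..., x_(k+1)): (x_(k+1), x_1, ..., x_k). *)
Definition last_for_first k (x : 'rV[R]_k.+2) : 'rV[R]_k.+1 :=
  \row_(j < k.+1) if j == ord0 then x ord0 ord_max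
                  else x ord0 (widen_ord (leqnSn k.+1) j).

Definition is_diff_quotient U k (f : 'rV[R]_k.+1 -> E) (g : 'rV[R]_k.+2 -> E) :=
  {within setpow U (n := k.+2), continuous g} /\
  (forall x, setpow U x -> x ord0 ord0 != x ord0 ord_max ->
     g x = (x ord0 ord_max - x ord0 ord0)^-1 *:
             (f (last_for_first x) - f (drop_last x))).

(* The map c^<k> on U^(k+1).  For [U] without isolated points and [E] Hausdorff,
   a continuous extension of the difference quotient is unique on U^(k+1), so
   the choice made by [xget] is immaterial there; when there is none, the value
   is the junk constant 0. *)
Fixpoint iter_diff_quotient U c k : 'rV[R]_k.+1 -> E :=
  match k with
  | 0 => fun x => c (x ord0 ord0)
  | k'.+1 => xget (fun=> 0)
      [set g | is_diff_quotient U (iter_diff_quotient U c (k := k')) g]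
  end.

Fixpoint is_Ck U c k : Prop :=
  match k with
  | 0 => {within U, continuous c}
  | k'.+1 => is_Ck U c k' /\
      exists g, is_diff_quotient U (iter_diff_quotient U c (k := k')) g
  end.

Definition is_smooth U c := forall k, is_Ck U c k.

Definition tvs_bounded (A : set E) :=
  forall W : set E, nbhs 0 W ->
    exists2 V : set R, nbhs 0 V & [set t *: x | t in V & x in A] `<=` W.

Definition is_BCinfty U c :=
  is_smooth U c /\
  forall j, tvs_bounded (iter_diff_quotient U c (k := j) @` setpow U (n := j.+1)).

Definition is_gauge q :=
  [/\ forall x, 0 <= q x,
      forall t x, q (t *: x) = `|t| * q x &
      forall r, 0 < r -> nbhs 0 (q @^-1` `[0, r[)].

Definition is_calibration (qs : nat -> E -> R) :=
  (forall n, is_gauge (qs n)) /\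
  (forall n x y, qs n (x + y) <= qs n.+1 x + qs n.+1 y).

(* ||c^<k>||_(q, oo), a supremum in [0, +oo]. *)
Definition gauge_sup q U c k : \bar R :=
  ereal_sup [set (q (iter_diff_quotient U c x))%:E | x in setpow U (n := k.+1)].

End Curves.

(* Main.v *)
Require Import Defs.
From HB Require Import structures.
From mathcomp Require Import all_boot all_order all_algebra.
From mathcomp Require Import all_classical all_reals all_analysis.
From mathcomp Require Import ring lra.
Set Implicit Arguments.
Unset Strict Implicit.
Unset Printing Implicit Defensive.
Import Order.TTheory GRing.Theory Num.Theory.
Import numFieldNormedType.Exports.
Local Open Scope classical_set_scope.
Local Open Scope ring_scope.

(** Place disjoint open intervals ]a_n, a_(n+1)[ of length
    2 (s_n + 1 / (n (n + 1))) side by side; their total length is finite, so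
    they accumulate at one point T.  On the n-th interval let gamma be the
    translate of chi_n gamma_n, where chi_n is a smooth cutoff with values in
    [0, 1] that is 1 on [- s_n, s_n] and 0 beyond s_n + 1 / (n (n + 1)); let
    gamma be 0 elsewhere.  Away from T the sum is locally finite.  Near T it is
    controlled by a race: differentiating chi_n, and leaving its support, costs
    powers of n, while gamma_n decays faster than every power of n.

    In a space that is not locally convex, derivatives do not control difference
    quotients, so everything is done with divided differences.  At a tuple of
    pairwise distinct points, gamma^<k> is the classical divided difference of
    order k, a symmetric function of the tuple.  Being C^k therefore means that
    these divided differences have limits at all tuples
    ([iter_diff_quotient_cvg], [diag_cvg_Ck]).  The recursion
    (y - x) [x, y, s] c = [y, s] c - [x, s] c reduces limits at a non-constant
    tuple to lower orders ([divdiff_cvg_offdiag]), so only the constant tuples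
    (a, ..., a) matter and smoothness becomes a local question at each point a.
    Products are treated with the Leibniz rule ([divdiff_leibniz]).

    The same recursion bounds divided differences.  If c is constant on both
    sides of a compact interval, a tuple of points either lies in a slightly
    larger compact interval, or sees only one of the constants, or has two
    entries at distance at least 1; hence smoothness already implies that all
    gamma^<k> are bounded ([gauge_divdiff_bounded]).  Likewise, a tuple that
    leaves [- r_n, r_n] but meets the support of chi_n has two entries at
    distance at least 1 / n ^ 2, so the estimates available on [- r_n, r_n]
    extend to all of R at the price of two powers of n per order
    ([rapid_extend]).  Finally k + 1 points near T meet at most k + 1 of the
    intervals, so the divided difference of gamma is a sum of at most k + 1
    small terms and tends to 0 ([glue_bumps]); gauges replace seminorms, a
    triangle inequality being available at the cost of changing the gauge
    ([gauge_add]).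

    The cutoffs come from exp (- 1 / x).  Its divided differences converge
    because of a mean value theorem: Rolle's theorem, applied to F minus its
    interpolation polynomial, turns a divided difference of F into one of F'
    ([divdiff_mean_value]). *)

(** * Divided differences *)

Section DividedDifference.
Context {R : fieldType}.
Implicit Types (V : lmodType R) (s : seq R) (x y : R).

(** Defined on lists rather than on rows, so that the symmetry in the nodes is
    just invariance of sums and products under permutation.  It is the divided
    difference when the nodes are pairwise distinct. *)
Definition divdiff V (f : R -> V) s : V :=
  \sum_(x <- s) (\prod_(y <- s | y != x) (x - y))^-1 *: f x.

Lemma divdiff_perm V (f : R -> V) s (t : seq R) : perm_eq s t -> divdiff f s = divdiff f t.
Proof.
move=> st; rewrite /divdiff (perm_big _ st) /=; apply: eq_bigr => x _.
by rewrite (perm_big _ st).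
Qed.

Lemma eq_divdiff V (f g : R -> V) s : {in s, f =1 g} -> divdiff f s = divdiff g s.
Proof. by move=> fg; apply: eq_big_seq => x /fg ->. Qed.

Lemma divdiff1 V (f : R -> V) x : divdiff f [:: x] = f x.
Proof. by rewrite /divdiff big_seq1 big_cons eqxx /= big_nil invr1 scale1r. Qed.

Lemma divdiff_sum V (I : Type) (r : seq I) (f : I -> R -> V) s :
  divdiff (fun t => \sum_(i <- r) f i t) s = \sum_(i <- r) divdiff (f i) s.
Proof.
rewrite exchange_big /=; apply: eq_bigr => x _.
by rewrite scaler_sumr.
Qed.

Lemma divdiffD V (f g : R -> V) s : divdiff (fun t => f t + g t) s = divdiff f s + divdiff g s.
Proof. by rewrite -big_split /=; apply: eq_bigr => x _; rewrite scalerDr. Qed.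

Lemma divdiffZ V a (f : R -> V) s : divdiff (fun t => a *: f t) s = a *: divdiff f s.
Proof.
by rewrite scaler_sumr; apply: eq_bigr => x _; rewrite !scalerA mulrC.
Qed.

Lemma divdiff0 V (f : R -> V) s : {in s, f =1 fun=> 0} -> divdiff f s = 0.
Proof.
move=> f0; rewrite (eq_divdiff f0) /divdiff big1// => x _; exact: scaler0.
Qed.

(** The weight of a node [t] of [s] in [x :: s] has the extra factor
    [(t - x)^-1], and the term of the node [x] vanishes.  The recursion, the
    slope formula and the Leibniz rule all come from this cancellation. *)
Lemma divdiff_cons_mul V (f : R -> V) x s : uniq (x :: s) ->
  divdiff (fun t => (t - x) *: f t) (x :: s) = divdiff f s.
Proof.
move=> /= /andP[xs us]; rewrite {1}/divdiff big_cons subrr scale0r scaler0 add0r.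
apply: eq_big_seq => t ts.
have xt : x != t by apply: contraNneq xs => ->.
rewrite big_cons xt scalerA invfM; congr (_ *: _).
by rewrite mulrC mulrA mulfV ?mul1r// subr_eq0 eq_sym.
Qed.

(** Write [y - x] as [(t - x) - (t - y)] inside the divided difference. *)
Lemma divdiff_rec V (f : R -> V) x y s : uniq [:: x, y & s] ->
  (y - x) *: divdiff f [:: x, y & s] = divdiff f (y :: s) - divdiff f (x :: s).
Proof.
move=> u; have p : perm_eq [:: x, y & s] [:: y, x & s].
  by rewrite (perm_catCA [:: x] [:: y] s).
rewrite -(divdiff_cons_mul f u) -(@divdiff_cons_mul _ f y (x :: s)); last first.
  by rewrite -(perm_uniq p).
rewrite -(divdiff_perm _ p) -divdiffZ -scaleN1r -divdiffZ -divdiffD.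
apply: eq_divdiff => t _ /=.
by rewrite scaleN1r -scalerBl; congr (_ *: _); ring.
Qed.

Lemma divdiff_cst V (v : V) s : uniq s -> (1 < size s)%N -> divdiff (fun=> v) s = 0.
Proof.
elim: {s}(size s).+1 {-2}s (ltnSn (size s)) => // n IH [|x [|y s]] //= sn u _.
have yx : y - x != 0.
  by rewrite subr_eq0; apply/eqP => e; move: u; rewrite e /= inE eqxx.
apply: (scalerI yx); rewrite scaler0 divdiff_rec//.
case: s sn u => [|z s] sn u; first by rewrite !divdiff1 subrr.
have us' : uniq [:: x, z & s].
  apply: (@subseq_uniq _ _ [:: x, y, z & s]) => //=.
  by rewrite eqxx; exact: (subseq_cons (z :: s)).
by rewrite !IH ?subrr//; case/andP: u.
Qed.

(** Trading the node [x] for the slope of [f] at [x] is what lets the Leibniz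
    rule be proved by induction on the nodes, for all functions at once. *)
Lemma divdiff_slope V (f : R -> V) x s : uniq (x :: s) -> s != [::] ->
  divdiff (fun t => (t - x)^-1 *: (f t - f x)) s = divdiff f (x :: s).
Proof.
move=> u s0; rewrite -(divdiff_cons_mul _ u).
have -> : divdiff f (x :: s) = divdiff (fun t => f t - f x) (x :: s).
  rewrite divdiffD [X in _ + X]divdiff_cst ?addr0//=; by case: s s0 u.
apply: eq_divdiff => t _; rewrite scalerA.
have [->|tx] := eqVneq t x; first by rewrite !subrr mul0r scale0r.
by rewrite divff ?scale1r// subr_eq0.
Qed.

(** With [x] the first node, [f t = f x + (t - x) * f1 t] where [f1] is the
    slope; the first summand gives the term [j = 0], and [f1] is treated by
    induction on the remaining nodes. *)
Lemma divdiff_leibniz V (f : R -> R^o) (g : R -> V) s : uniq s ->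
  divdiff (fun t => f t *: g t) s =
  \sum_(j < size s) (divdiff f (take j.+1 s) : R) *: divdiff g (drop j s).
Proof.
elim: s f => [|x s IH] f u; first by rewrite /divdiff big_nil big_ord0.
rewrite big_ord_recl /= take0 divdiff1.
have us : uniq s by case/andP: u.
have -> : divdiff (fun t => f t *: g t) (x :: s) = f x *: divdiff g (x :: s) +
    divdiff (fun t => ((t - x)^-1 * (f t - f x)) *: g t) s.
  rewrite -(divdiff_cons_mul _ u) -divdiffZ -divdiffD; apply: eq_divdiff => t _.
  rewrite scalerA; have [->|tx] := eqVneq t x.
    by rewrite !subrr mul0r scale0r addr0.
  by rewrite mulrA divff ?subr_eq0// mul1r -scalerDl addrC subrK.
congr (_ + _); rewrite (IH (fun t => (t - x)^-1 *: (f t - f x)))//.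
apply: eq_bigr => j _; congr (_ *: _).
rewrite /bump /= add1n divdiff_slope//.
- case/andP: u => xs _; apply/andP; split; last exact: take_uniq.
  by apply: contra xs; exact: mem_take.
- by rewrite -size_eq0 size_take; case: s {IH u us} j => [[]|y s j] //=; case: ifP.
Qed.

Lemma divdiff_affine V (f : R -> V) a b s : a != 0 -> uniq s ->
  divdiff (fun t => f (a * t + b)) s =
  a ^+ (size s).-1 *: divdiff f [seq a * t + b | t <- s].
Proof.
move=> a0 us; rewrite /divdiff big_map scaler_sumr; apply: eq_big_seq => x xs.
rewrite scalerA; congr (_ *: _); rewrite big_map.
rewrite [X in _ * X^-1](eq_bigl (fun y => y != x)); last first.
  move=> y /=; congr (~~ _); apply/eqP/eqP => [|-> //].
  by move/addIr/(mulfI a0).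
rewrite [X in _ * X^-1](eq_bigr (fun y => a * (x - y))); last first.
  by move=> y _; rewrite mulrBr opprD addrACA subrr addr0.
rewrite big_split /= big_const_seq -Monoid.iteropE /=.
have -> : count (fun y => y != x) s = (size s).-1.
  by rewrite -(count_predC (pred1 x) s) /= count_uniq_mem// xs add1n.
rewrite invfM mulrA -[iterop _ _ _ _]/(a ^+ (size s).-1) divff ?mul1r//.
exact: expf_neq0.
Qed.

End DividedDifference.

(** * Gauges on topological vector spaces *)

Section TopologicalLmodule.
Context {R : realType} {E : topologicalLmodType R}.
Implicit Types (q : E -> R) (W : set E) (x y : E).

Lemma tvs_cvgD {T : Type} (F : set_system T) {FF : Filter F} (f g : T -> E) x y :
  f @ F --> x -> g @ F --> y -> (fun t => f t + g t) @ F --> x + y.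
Proof.
move=> fx gy.
apply: (@cvg_comp _ _ _ (fun t => (f t, g t)) (fun z => z.1 + z.2) F _ _
  (cvg_pair fx gy) (@add_continuous E (x, y))).
Qed.

Lemma tvs_cvgZ {T : Type} (F : set_system T) {FF : Filter F}
    (f : T -> R) (g : T -> E) (a : R) y :
  f @ F --> a -> g @ F --> y -> (fun t => f t *: g t) @ F --> a *: y.
Proof.
move=> fx gy.
have fg : (fun t => (f t : R^o, g t)) @ F --> (a : R^o, y).
  exact: cvg_pair fx gy.
have h := @scale_continuous R E (a, y).
exact: (cvg_comp _ _ fg h).
Qed.

Lemma tvs_cvg_sum {T : Type} (F : set_system T) {FF : Filter F} (I : Type)
    (r : seq I) (f : I -> T -> E) (l : I -> E) :
  (forall i, f i @ F --> l i) ->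
  (fun t => \sum_(i <- r) f i t) @ F --> \sum_(i <- r) l i.
Proof.
move=> fl; elim: r => [|i r IH].
  by rewrite big_nil; under eq_fun do rewrite big_nil; exact: cvg_cst.
by rewrite big_cons; under eq_fun do rewrite big_cons; exact: tvs_cvgD.
Qed.

Lemma nbhs0_add W : nbhs 0 W ->
  exists2 V : set E, nbhs 0 V & forall x y, V x -> V y -> W (x + y).
Proof.
move=> W0; have := @add_continuous E (0, 0) W; rewrite /= addr0 => /(_ W0).
move=> [[A B] /= [A0 B0] AB]; exists (A `&` B); first exact: filterI.
by move=> x y [Ax _] [_ By]; exact: (AB (x, y)).
Qed.

Lemma tvs_shift_cvg (x y : E) : (fun z => x + z) @ y --> x + y.
Proof. apply: (@tvs_cvgD _ (nbhs y) _ (fun=> x) id); [exact: cvg_cst|exact: cvg_id]. Qed.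

Lemma tvs_scale_cvg (a : R) (y : E) : (fun z => a *: z) @ y --> a *: y.
Proof. apply: (@tvs_cvgZ _ (nbhs y) _ (fun=> a) id); [exact: cvg_cst|exact: cvg_id]. Qed.

Lemma nbhs_translate x W : nbhs x W <-> nbhs 0 [set y | W (x + y)].
Proof.
split=> Wx.
- by have := @tvs_shift_cvg x 0; rewrite addr0 => /(_ _ Wx).
- have := @tvs_shift_cvg (- x) x; rewrite addNr => /(_ _ Wx) Wx'.
  apply: filterS (Wx' : nbhs x _) => y /=.
  by rewrite addrA subrr add0r.
Qed.

(** Continuity of scaling at (0, 0) provides [d] and [B] with [a B] inside [W]
    for all [a] smaller than [d]; the union of these [a B] is balanced. *)
Lemma nbhs0_balanced W : nbhs 0 W -> exists V : set E,
  [/\ nbhs 0 V, V `<=` W & forall (a : R) x, `|a| <= 1 -> V x -> V (a *: x)].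
Proof.
move=> W0; have := @scale_continuous R E (0, 0) W; rewrite /= scale0r => /(_ W0).
move=> [[A B] /= [A0 B0] AB].
have [d /= d0 dA] := A0.
exists [set x | exists a : R, exists2 y, `|a| < d & B y /\ x = a *: y]; split.
- have d20 : d / 2 != 0 by rewrite gt_eqF// divr_gt0.
  have := @tvs_scale_cvg (d / 2)^-1 0; rewrite scaler0 => /(_ _ B0) B0'.
  apply: filterS (B0' : nbhs 0 _) => y /= By.
  exists (d / 2), ((d / 2)^-1 *: y).
    by rewrite gtr0_norm ?divr_gt0// ltr_pdivrMr// ltr_pMr// ltr1n.
  by split => //; rewrite scalerA divff// scale1r.
- move=> _ [a [y ad [By ->]]]; apply: (AB (a, y)); split => //=.
  by apply: dA; rewrite /= sub0r normrN.
- move=> b _ b1 [a [y ad [By ->]]]; exists (b * a), y; last by rewrite scalerA.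
  rewrite normrM; apply: le_lt_trans ad; exact: ler_piMl.
Qed.

Lemma gauge0 q : is_gauge q -> q 0 = 0.
Proof. by case=> _ h _; rewrite -(scale0r (0 : E)) h normr0 mul0r. Qed.

Lemma gauge_lt q (e : R) : is_gauge q -> 0 < e -> \forall x \near 0, q x < e.
Proof.
move=> [q0 _ qn] e0; apply: filterS (qn e e0) => x /=.
by rewrite in_itv /= => /andP[].
Qed.

(** Gauges generate the topology: take the Minkowski functional of a balanced
    neighbourhood.  It is homogeneous because the neighbourhood is balanced. *)
Lemma nbhs0_gauge W : nbhs 0 W ->
  exists2 q, is_gauge q & forall x, q x < 1 -> W x.
Proof.
move=> /nbhs0_balanced [V [V0 VW Vb]].
pose S x := [set a : R | 0 < a /\ V (a^-1 *: x)].
have S0 x : S x !=set0.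
  have : (fun a : R => a *: x) @ (0 : R) --> 0 *: x.
    apply: (@tvs_cvgZ _ (nbhs (0:R)) _ id (fun=> x)); [exact: cvg_id|exact: cvg_cst].
  rewrite scale0r => /(_ _ V0) [d /= d0 dV].
  exists (d / 2)^-1; split; first by rewrite invr_gt0 divr_gt0.
  rewrite invrK; apply: dV => /=; rewrite sub0r normrN gtr0_norm ?divr_gt0//.
  by rewrite ltr_pdivrMr// ltr_pMr// ltr1n.
have Slb x : lbound (S x) 0 by move=> a [/ltW].
have Sinf x : has_inf (S x) by split; [exact: S0|exists 0; exact: Slb].
have q_le (a : R) x : a != 0 -> inf (S (a *: x)) <= `|a| * inf (S x).
  move=> a0; have na : 0 < `|a| by rewrite normr_gt0.
  rewrite -ler_pdivrMl//; apply: lb_le_inf => // t [t0 Vt].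
  rewrite ler_pdivrMl//; apply: ge_inf; first by exists 0; exact: Slb.
  split; first exact: mulr_gt0.
  have -> : (`|a| * t)^-1 *: (a *: x) = (`|a|^-1 * a) *: (t^-1 *: x).
    by rewrite !scalerA invfM; congr (_ *: _); rewrite mulrAC.
  by apply: Vb Vt; rewrite normrM normfV normr_id mulVf ?gt_eqF.
exists (fun x => inf (S x)); first split.
- by move=> x; apply: lb_le_inf.
- move=> a x; have [->|a0] := eqVneq a 0.
    rewrite normr0 mul0r scale0r; apply/eqP; rewrite eq_le; apply/andP; split; last first.
      exact: lb_le_inf.
    apply/ler_addgt0Pl => e e0; rewrite addr0; apply: ge_inf; first by exists 0; exact: Slb.
    by split=> //; rewrite scaler0; exact: nbhs_singleton.
  apply/eqP; rewrite eq_le q_le//= -ler_pdivlMl ?normr_gt0// -normfV.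
  rewrite -{1}[x]scale1r -(mulVf a0) -scalerA; apply: q_le; exact: invr_neq0.
- move=> r r0.
  have := @tvs_scale_cvg (r / 2)^-1 0; rewrite scaler0 => /(_ _ V0) V0'.
  apply: filterS (V0' : nbhs 0 _) => x /= Vx.
  rewrite in_itv /=; apply/andP; split; first exact: lb_le_inf.
  apply: (@le_lt_trans _ _ (r / 2)); last by rewrite ltr_pdivrMr// ltr_pMr// ltr1n.
  by apply: ge_inf; [exists 0; exact: Slb|split => //; rewrite divr_gt0].
- move=> x /(inf_lt (S0 x)) [a [a0 Va] a1]; apply: VW.
  rewrite -[x]scale1r -(divff (lt0r_neq0 a0)) -scalerA.
  by apply: Vb Va; rewrite gtr0_norm// ltW.
Qed.

(** The substitute for the triangle inequality: if [V + V] lies in [{q < 1}]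
    and [{q' < 1}] lies in [V], then homogeneity yields the claim. *)
Lemma gauge_add q : is_gauge q ->
  exists2 q', is_gauge q' & forall x y, q (x + y) <= q' x + q' y.
Proof.
move=> gq; have [V V0 VV] := nbhs0_add (gauge_lt gq ltr01).
have [q' gq' q'V] := nbhs0_gauge V0; exists q' => // x y.
case: (gq) => _ qZ _; case: (gq') => q'0 q'Z _.
apply/ler_addgt0Pl => e e0; set b := e + _.
have b0 : 0 < b by apply: ltr_wpDr => //; exact: addr_ge0.
(* [b] exceeds both [q' x] and [q' y], so both rescaled vectors lie in [V]. *)
have lb z : q' z < b -> V (b^-1 *: z).
  move=> zb; apply: q'V; rewrite q'Z normfV gtr0_norm//.
  by rewrite ltr_pdivrMl// mulr1.
have {lb}: q (b^-1 *: x + b^-1 *: y) < 1.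
  apply: VV; apply: lb; rewrite /b.
    by rewrite addrCA ltrDl ltr_wpDr.
  by rewrite addrA ltrDr ltr_wpDr.
rewrite -scalerDr qZ normfV gtr0_norm// ltr_pdivrMl// mulr1; exact: ltW.
Qed.

Lemma gauge_sum q n : is_gauge q -> exists2 q', is_gauge q' &
  forall (I : Type) (r : seq I) (f : I -> E), (size r <= n.+1)%N ->
    q (\sum_(i <- r) f i) <= \sum_(i <- r) q' (f i).
Proof.
elim: n q => [|n IH] q gq.
  exists q => // I [|i [|//]] f _; first by rewrite !big_nil gauge0.
  by rewrite !big_seq1.
have [q1 gq1 qq1] := gauge_add gq; have [q2 gq2 q12] := IH _ gq1.
exists q2 => // I [|i r] f /= sr; first by rewrite !big_nil gauge0.
rewrite !big_cons; apply: le_trans (qq1 _ _) _; apply: lerD; last exact: q12.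
by have := q12 _ [:: i] f; rewrite !big_seq1; exact.
Qed.

Lemma tvs_boundedP (A : set E) :
  (forall q, is_gauge q -> exists M, forall x, A x -> q x <= M) -> tvs_bounded A.
Proof.
move=> bA W W0; have [q gq qW] := nbhs0_gauge W0.
have [M AM] := bA q gq; pose N := Num.max M 0 + 1.
have N0 : 0 < N by rewrite ltr_wpDl// le_max lexx orbT.
exists [set a : R | `|a| < N^-1].
  exists N^-1; first by rewrite /= invr_gt0.
  by move=> a /=; rewrite sub0r normrN.
move=> _ [a /= aN [x Ax <-]]; apply: qW; case: (gq) => q0 -> _.
have [->|a0] := eqVneq a 0; first by rewrite normr0 mul0r.
apply: (@lt_le_trans _ _ (`|a| * N)).
  rewrite ltr_pM2l ?normr_gt0//; apply: le_lt_trans (AM _ Ax) _.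
  by apply: (@le_lt_trans _ _ (Num.max M 0)); rewrite ?le_max ?lexx// ltrDl.
by rewrite -ler_pdivlMr// div1r ltW.
Qed.

End TopologicalLmodule.

(** * Tuples of distinct points converging to a tuple *)

Section TupleFilter.
Context {R : realType}.
Implicit Types (U : set R) (p s : seq R) (d x y : R).

Definition tuple_close d p s := all2 (fun x y => `|x - y| < d) p s.

Definition all_in U s := forall x, x \in s -> U x.

(** Convergence of tuples of pairwise distinct points of [U] to the tuple [p],
    entry by entry; the entries of [p] may coincide. *)
Definition tuple_near U p : set_system (seq R) :=
  filter_from [set d : R | 0 < d]
    (fun d => [set s | [/\ uniq s, all_in U s & tuple_close d p s]]).

(** No point of [U] is isolated, in the form that allows perturbing a tuple to
    one with pairwise distinct entries. *)
Definition accumulating U :=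
  forall x d s, U x -> 0 < d -> exists y, [/\ U y, `|x - y| < d & y \notin s].

Lemma all_in_cons U x s : all_in U (x :: s) <-> U x /\ all_in U s.
Proof.
split=> [h|[Ux h] y]; last by rewrite inE => /predU1P[->|/h].
by split=> [|y ys]; apply: h; rewrite inE ?eqxx// ys orbT.
Qed.

Lemma tuple_close_le d e p s : d <= e -> tuple_close d p s -> tuple_close e p s.
Proof.
move=> de; elim: p s => [|x p IH] [|y s] //= /andP[xy /IH ->].
by rewrite (lt_le_trans xy de).
Qed.

Lemma tuple_close_size d p s : tuple_close d p s -> size s = size p.
Proof. by elim: p s => [|x p IH] [|y s] //= /andP[_ /IH ->]. Qed.

Lemma tuple_close_refl d p : 0 < d -> tuple_close d p p.
Proof. by move=> d0; elim: p => //= x p ->; rewrite subrr normr0 d0. Qed.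

Lemma tuple_close_trans d e p s t :
  tuple_close d p s -> tuple_close e s t -> tuple_close (d + e) p t.
Proof.
elim: p s t => [|x p IH] [|y s] [|z t] //= /andP[xy ps] /andP[yz st].
rewrite (IH _ _ ps st) andbT.
have -> : x - z = (x - y) + (y - z) by ring.
by apply: le_lt_trans (ler_normD _ _) _; exact: ltrD.
Qed.

Lemma tuple_close_take d p s i : tuple_close d p s -> tuple_close d (take i p) (take i s).
Proof.
elim: p s i => [|x p IH] [|y s] [|i] //= /andP[-> ps] /=; exact: IH.
Qed.

Lemma tuple_close_drop d p s i : tuple_close d p s -> tuple_close d (drop i p) (drop i s).
Proof.
by elim: p s i => [|x p IH] [|y s] [|i] //= /andP[xy ps]; rewrite ?xy //; exact: IH.
Qed.

Lemma tuple_close_nth d p s i : (i < size p)%N -> tuple_close d p s -> `|p`_i - s`_i| < d.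
Proof.
by elim: p s i => [|x p IH] [|y s] [|i] //= ip /andP[xy ps] //; exact: IH.
Qed.

Lemma tuple_close_nseqP d n x s : tuple_close d (nseq n x) s <->
  size s = n /\ forall y, y \in s -> `|x - y| < d.
Proof.
split; first by elim: n s => [|n IH] [|y s] //= /andP[xy /IH[<- h]]; split=> // z;
  rewrite inE => /predU1P[->|/h].
elim: n s => [|n IH] [|y s] //= [] // [sn] h.
rewrite h ?mem_head//= IH//; split=> // z zs.
by apply: h; rewrite inE zs orbT.
Qed.

#[global] Instance tuple_near_filter U p : Filter (tuple_near U p).
Proof.
apply: filter_from_filter; first by exists 1 => /=.
move=> d e /= d0 e0; exists (Num.min d e); first by rewrite /= lt_min d0 e0.
move=> s [us Us ps]; split; split=> //; apply: tuple_close_le ps.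
- by rewrite ge_min lexx.
- by rewrite ge_min lexx orbT.
Qed.

Lemma tuple_near_proper U p : accumulating U -> all_in U p ->
  ProperFilter (tuple_near U p).
Proof.
move=> aU Up; apply: filter_from_proper => d /= d0.
elim: p Up => [|x p IH]; first by exists [::].
move=> /all_in_cons[Ux /IH [s [us Us ps]]].
have [y [Uy xy ys]] := aU x d s Ux d0.
by exists (y :: s); split=> /=; [rewrite ys|apply/all_in_cons|rewrite xy].
Qed.

Lemma tuple_nearE U p : \forall s \near tuple_near U p,
  [/\ uniq s, all_in U s & size s = size p].
Proof.
exists 1 => /=; first exact: ltr01.
by move=> s [us Us /tuple_close_size].
Qed.

Lemma tuple_near_map U p (m : seq R -> seq R) :
  (forall s, subseq (m s) s) -> (forall d s, tuple_close d p s -> tuple_close d (m p) (m s)) ->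
  m @ tuple_near U p --> tuple_near U (m p).
Proof.
move=> sm cm A [d d0 dA]; exists d => // s [us Us ps] /=.
apply: dA; split; [exact: subseq_uniq (sm s) us| |exact: cm].
by move=> x /(mem_subseq (sm s)); exact: Us.
Qed.

Lemma tuple_near_take U p i : take i @ tuple_near U p --> tuple_near U (take i p).
Proof.
by apply: tuple_near_map => [s|d s]; [exact: take_subseq|exact: tuple_close_take].
Qed.

Lemma tuple_near_drop U p i : drop i @ tuple_near U p --> tuple_near U (drop i p).
Proof.
by apply: tuple_near_map => [s|d s]; [exact: drop_subseq|exact: tuple_close_drop].
Qed.

Lemma tuple_near_nth U p i : (i < size p)%N ->
  (fun s => s`_i) @ tuple_near U p --> p`_i.
Proof.
move=> ip A [d /= d0 dA]; exists d => // s [_ _ ps] /=; apply: dA => /=.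
exact: tuple_close_nth.
Qed.

Definition rem_nth i s := take i s ++ drop i.+1 s.

Lemma rem_nth_subseq i s : subseq (rem_nth i s) s.
Proof.
elim: s i => [|x s IH] [|i] //; rewrite /rem_nth /=.
  by rewrite drop0; exact: subseq_cons.
by rewrite eqxx; exact: IH.
Qed.

Lemma tuple_close_rem_nth d p s i : tuple_close d p s -> tuple_close d (rem_nth i p) (rem_nth i s).
Proof.
elim: p s i => [|x p IH] [|y s] [|i] //= /andP[xy ps]; rewrite /rem_nth /=.
  by rewrite !drop0.
by rewrite xy; exact: IH.
Qed.

Lemma size_rem_nth i s : (i < size s)%N -> size (rem_nth i s) = (size s).-1.
Proof.
move=> si; rewrite size_cat size_takel ?size_drop; last exact: ltnW.
by rewrite subnS -subn1 addnBA ?subn_gt0// subnKC ?subn1// ltnW.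
Qed.

Lemma tuple_near_rem U p i :
  rem_nth i @ tuple_near U p --> tuple_near U (rem_nth i p).
Proof.
by apply: tuple_near_map => [s|d s]; [exact: rem_nth_subseq|exact: tuple_close_rem_nth].
Qed.

Lemma all_in_rem U p i : all_in U p -> all_in U (rem_nth i p).
Proof. by move=> Up x /(mem_subseq (rem_nth_subseq i p)); exact: Up. Qed.

(** The recursion for the nodes in positions 0 and [j + 1], in a form that can
    be passed to the limit since removing a fixed position is continuous. *)
Lemma divdiff_rem (V : lmodType R) (f : R -> V) s j : uniq s -> (j.+1 < size s)%N ->
  divdiff f s = (s`_j.+1 - s`_0)^-1 *: (divdiff f (rem_nth 0 s) - divdiff f (rem_nth j.+1 s)).
Proof.
case: s => // x s us; rewrite ltnS => js /=.
have xs : (s`_j - x) != 0.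
  rewrite subr_eq0; apply: contraTneq us => <-.
  by rewrite /= mem_nth.
have pe : perm_eq s (s`_j :: rem_nth j s).
  by rewrite -{1}(cat_take_drop j s) (drop_nth 0 js) perm_catC /= perm_cons perm_catC.
apply: (scalerI xs); rewrite scalerA divff// scale1r.
have pe' : perm_eq (x :: s) [:: x, s`_j & rem_nth j s] by rewrite perm_cons.
rewrite (divdiff_perm f pe') divdiff_rec; last by rewrite -(perm_uniq pe').
congr (_ - _); rewrite -(divdiff_perm f pe); congr divdiff.
by rewrite /rem_nth /= drop0.
Qed.

End TupleFilter.

(** * Limits of divided differences *)

Section Limits.
Context {R : realType} {E : topologicalLmodType R}.
Implicit Types (U : set R) (p s : seq R) (c : R -> E) (L : E).

Definition divdiff_cvg U c p L := divdiff c @ tuple_near U p --> L.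

(** Limits at constant tuples only; the limit at [(a, ..., a)] is the [k]-th
    Taylor coefficient at [a]. *)
Definition diag_cvg U c k := forall a, U a -> exists L, divdiff_cvg U c (nseq k.+1 a) L.

(** If two entries of [p] differ, the recursion writes the divided difference
    near [p] through those of tuples with one entry less, divided by a
    difference that stays away from 0. *)
Lemma divdiff_cvg_offdiag U c p : (forall k, (k < size p)%N -> diag_cvg U c k) ->
  p != [::] -> all_in U p -> exists L, divdiff_cvg U c p L.
Proof.
move: {2}(size p) (erefl (size p)) => n sn dc; elim: n p sn dc => [|n IH] p sn dc p0 Up.
  by rewrite -size_eq0 sn in p0.
case: p sn dc p0 Up => // x p [sn] dc _ Up.
have /all_in_cons[Ux Up'] := Up.
have [/all_pred1P ->|] := boolP (all (pred1 x) p).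
  by have [|L] := dc (size p) _ x Ux; [rewrite /=|exists L].
move=> /allPn[y yp /= yx]; pose j := index y p.
have jp : (j < size p)%N by rewrite index_mem.
have pj : p`_j = y by rewrite nth_index.
have sz i : (i < (size p).+1)%N -> size (rem_nth i (x :: p)) = n.
  by move=> ip; rewrite size_rem_nth//= sn.
have h i : (i < (size p).+1)%N -> exists L, divdiff_cvg U c (rem_nth i (x :: p)) L.
  move=> ip; apply: IH; first exact: sz.
  - by move=> k; rewrite sz// -sn => kp; apply: dc; rewrite /= ltnW.
  - by rewrite -size_eq0 sz// -sn; case: (p) jp.
  - exact: all_in_rem.
have [L0 hL0] := h 0%N isT; have [L1 hL1] := h j.+1 jp.
exists ((y - x)^-1 *: (L0 - L1)).
have : (fun s => (s`_j.+1 - s`_0)^-1 *: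
    (divdiff c (rem_nth 0 s) - divdiff c (rem_nth j.+1 s))) @ tuple_near U (x :: p) -->
    (y - x)^-1 *: (L0 - L1).
  apply: tvs_cvgZ.
    apply: cvgV; first by rewrite subr_eq0.
    apply: cvgB.
      by rewrite -pj; apply: (@tuple_near_nth _ U (x :: p) j.+1).
    exact: (@tuple_near_nth _ U (x :: p) 0).
  apply: tvs_cvgD.
    exact: (cvg_comp _ _ (@tuple_near_rem _ U (x :: p) 0) hL0).
  have h1 := cvg_comp _ _ (@tuple_near_rem _ U (x :: p) j.+1) hL1.
  exact: (cvg_comp _ _ h1 (@opp_continuous E L1)).
apply: cvg_trans; apply: near_eq_cvg.
near=> s; have [us _ ss] : [/\ uniq s, all_in U s & size s = size (x :: p)].
  by near: s; exact: tuple_nearE.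
by rewrite -divdiff_rem// ss.
Unshelve. all: by end_near. Qed.

(** Near a constant tuple all nodes are close to the same point [a], so only
    the germ of the function at [a] counts. *)
Lemma divdiff_cvg_local U U' c c' a k L (d : R) : 0 < d ->
  (forall t, U' t -> `|a - t| < d -> U t /\ c' t = c t) ->
  divdiff_cvg U c (nseq k a) L -> divdiff_cvg U' c' (nseq k a) L.
Proof.
move=> d0 h cL W /cL [e /= e0 eW]; exists (Num.min d e).
  by rewrite /= lt_min d0 e0.
move=> s [us Us /tuple_close_nseqP [ss sa]] /=.
have hs x : x \in s -> U x /\ c' x = c x.
  by move=> xs; apply: h; [exact: Us|apply: lt_le_trans (sa x xs) _; rewrite ge_min lexx].
rewrite (@eq_divdiff _ _ c' c) => [|x /hs[]//].
apply: eW; split=> //; first by move=> x /hs[].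
apply/tuple_close_nseqP; split=> // x xs.
by apply: lt_le_trans (sa x xs) _; rewrite ge_min lexx orbT.
Qed.

Lemma divdiff_cvg_unique U c p L L' : hausdorff_space E -> accumulating U ->
  all_in U p -> divdiff_cvg U c p L -> divdiff_cvg U c p L' -> L = L'.
Proof.
move=> hE aU Up; have ? := tuple_near_proper aU Up.
exact: cvg_unique.
Qed.

(** A tuple of distinct points belongs to every set of the filter at itself. *)
Lemma divdiff_cvg_val U c p L : hausdorff_space E -> all_in U p -> uniq p ->
  divdiff_cvg U c p L -> L = divdiff c p.
Proof.
move=> hE Up up cL; apply: hE => A B /cL [d /= d0 dA] Bp.
exists (divdiff c p); split; last exact: nbhs_singleton.
by apply: dA; split=> //; exact: tuple_close_refl.
Qed.

End Limits.

(** * Rows and lists of nodes *)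

Section Rows.
Context {R : realType}.
Implicit Types (U : set R) (s : seq R).

Definition rowseq n (x : 'rV[R]_n) : seq R := [seq x ord0 i | i <- enum 'I_n].

Definition seqrow n s : 'rV[R]_n := \row_i s`_i.

Lemma size_rowseq n (x : 'rV[R]_n) : size (rowseq x) = n.
Proof. by rewrite size_map size_enum_ord. Qed.

Lemma nth_rowseq n (x : 'rV[R]_n) (i : 'I_n) : (rowseq x)`_i = x ord0 i.
Proof. by rewrite (nth_map i) ?size_enum_ord// nth_ord_enum. Qed.

Lemma seqrowK n s : size s = n -> rowseq (seqrow n s) = s.
Proof.
move=> sn; apply: (@eq_from_nth _ 0); rewrite size_rowseq// => i i_n.
by rewrite (nth_rowseq _ (Ordinal i_n)) mxE.
Qed.

Lemma all_in_rowseq U n (x : 'rV[R]_n) : all_in U (rowseq x) <-> setpow U x.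
Proof.
split=> [h i|h _ /mapP[i _ ->]]; last exact: h.
by apply: h; apply: map_f; rewrite mem_enum.
Qed.

Lemma tuple_closeP (d : R) p s : size s = size p ->
  (forall i, (i < size p)%N -> `|p`_i - s`_i| < d) -> tuple_close d p s.
Proof.
elim: p s => [|x p IH] [|y s] //= [sp] h.
by rewrite (h 0%N)// IH// => i ip; exact: (h i.+1).
Qed.

Lemma tuple_close_rcons (d x y : R) p s : size s = size p ->
  tuple_close d (rcons p x) (rcons s y) = tuple_close d p s && (`|x - y| < d).
Proof.
by elim: p s => [|z p IH] [|t s] //= => [_|[/IH ->]]; rewrite ?andbT ?andbA.
Qed.

Lemma tuple_close_rowseq n (d : R) (x y : 'rV[R]_n) : 0 < d ->
  tuple_close d (rowseq x) (rowseq y) <-> ball x d y.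
Proof.
move=> d0; split=> [xy|[_ xy]].
  split=> // i j; rewrite /ball /= ord1 -!nth_rowseq.
  by apply: tuple_close_nth => //; rewrite size_rowseq.
apply: tuple_closeP => [|i]; rewrite ?size_rowseq// => i_n.
by rewrite (nth_rowseq _ (Ordinal i_n)) (nth_rowseq _ (Ordinal i_n)); exact: xy.
Qed.

Lemma rowseq_drop_last k (x : 'rV[R]_k.+2) :
  rowseq (drop_last x) = rem_nth k.+1 (rowseq x).
Proof.
have sz : size (rem_nth k.+1 (rowseq x)) = k.+1.
  by rewrite size_rem_nth size_rowseq.
apply: (@eq_from_nth _ 0); rewrite size_rowseq ?sz// => i ik.
rewrite (nth_rowseq _ (Ordinal ik)) mxE /rem_nth drop_oversize ?size_rowseq// cats0.
by rewrite nth_take// -nth_rowseq.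
Qed.

(** The definition of the iterated quotients moves the last entry to the front,
    while removing the first node leaves it at the end. *)
Lemma rowseq_last_for_first k (x : 'rV[R]_k.+2) :
  rem_nth 0 (rowseq x) = rot 1 (rowseq (last_for_first x)).
Proof.
have -> : rem_nth 0 (rowseq x) = rcons (take k (behead (rowseq x))) (x ord0 ord_max).
  rewrite /rem_nth take0 /= drop1 -[LHS](cat_take_drop k) -cats1; congr (_ ++ _).
  rewrite (drop_nth 0) ?size_behead ?size_rowseq// drop_oversize ?size_behead ?size_rowseq//.
  by rewrite nth_behead -(nth_rowseq x ord_max).
have -> : rowseq (last_for_first x) = x ord0 ord_max :: take k (behead (rowseq x)).
  have st : size (take k (behead (rowseq x))) = k.
    by rewrite size_takel// size_behead size_rowseq.
  apply: (@eq_from_nth _ 0); rewrite size_rowseq /= ?st// => i ik.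
  rewrite (nth_rowseq _ (Ordinal ik)) mxE; case: i ik => [|i] ik //=.
  by rewrite nth_take// nth_behead -nth_rowseq.
by rewrite rot1_cons.
Qed.

End Rows.

(** * Iterated difference quotients as limits of divided differences *)

Section Interface.
Context {R : realType} {E : topologicalLmodType R}.
Implicit Types (U : set R) (c : R -> E) (L : E).

Lemma continuous_divdiff_cvg U c k (g : 'rV[R]_k.+1 -> E) :
  {within setpow U (n := k.+1), continuous g} ->
  (forall x, setpow U x -> uniq (rowseq x) -> g x = divdiff c (rowseq x)) ->
  forall x, setpow U x -> divdiff_cvg U c (rowseq x) (g x).
Proof.
move=> /subspace_continuousP cg gE x Ux W /(cg x Ux) /=.
rewrite /within /= => /nbhs_ballP[d /= d0 dW]; exists d => // s [us Us xs] /=.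
have ss : size s = k.+1 by rewrite (tuple_close_size xs) size_rowseq.
rewrite -(seqrowK ss) in us Us xs *.
have Us' := (all_in_rowseq U (seqrow k.+1 s)).1 Us.
by rewrite -gE//; apply: dW => //; apply/tuple_close_rowseq.
Qed.

(** A function obtained by passing to the limit is continuous: values at nearby
    tuples are approximated by divided differences at distinct nodes, which are
    in turn close to the value at [x]. *)
Lemma divdiff_cvg_continuous U c k (g : 'rV[R]_k.+1 -> E) : accumulating U ->
  (forall x, setpow U x -> divdiff_cvg U c (rowseq x) (g x)) ->
  {within setpow U (n := k.+1), continuous g}.
Proof.
move=> aU cg; apply/subspace_continuousP => x Ux W.
move=> /nbhs_translate /nbhs0_add[V V0 VW].
have nV y : nbhs y [set z | V (z - y)].
  apply/nbhs_translate; apply: filterS V0 => z /=.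
  by rewrite addrC addKr.
have nV' y : nbhs y [set z | V (y - z)].
  apply/nbhs_translate; have := @opp_continuous E 0; rewrite /continuous_at oppr0.
  by move=> /(_ _ V0); apply: (@filterS _ (nbhs (0 : E))) => z /=; rewrite opprD addNKr.
have [d /= d0 dV] := cg x Ux _ (nV (g x)).
rewrite /within /=; apply/nbhs_ballP; exists (d / 2); first by rewrite /= divr_gt0.
move=> y /= xy Uy.
have Py := tuple_near_proper aU ((all_in_rowseq U y).2 Uy).
have d2 : 0 < d / 2 by rewrite divr_gt0.
have : \forall s \near tuple_near U (rowseq y),
    V (g y - divdiff c s) /\ [/\ uniq s, all_in U s & tuple_close (d / 2) (rowseq y) s].
  apply: filterI; first exact: (cg y Uy _ (nV' (g y))).
  by exists (d / 2).
move=> /filter_ex[s [Vs [us Us ys]]].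
have : V (divdiff c s - g x).
  apply: dV; split=> //; rewrite (splitr d); apply: tuple_close_trans ys.
  exact/tuple_close_rowseq.
move=> /VW /(_ Vs) /=.
by rewrite addrA [g x + _]addrC subrK [divdiff c s + _]addrC subrK.
Qed.

Lemma divdiff_cvg_rot1 U c p L : divdiff_cvg U c p L -> divdiff_cvg U c (rot 1 p) L.
Proof.
case: p => // x p; rewrite rot1_cons => cL W /cL [d /= d0 dW]; exists d => // s.
case/lastP: s => [[_ _ /tuple_close_size]|s y [us Us ps]] /=.
  by rewrite size_rcons.
rewrite (@divdiff_perm _ _ c _ (y :: s)); last by rewrite perm_rcons.
apply: dW; split.
- by move: us; rewrite rcons_uniq.
- by move=> z zs; apply: Us; rewrite mem_rcons.
- have sp : size s = size p by move: (tuple_close_size ps); rewrite !size_rcons => -[].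
  by move: ps; rewrite tuple_close_rcons// andbC.
Qed.

Lemma setpow_last_for_first U k (x : 'rV[R]_k.+2) :
  setpow U x -> setpow U (last_for_first x).
Proof. by move=> Ux j; rewrite mxE; case: ifP. Qed.

Lemma setpow_drop_last U k (x : 'rV[R]_k.+2) : setpow U x -> setpow U (drop_last x).
Proof. by move=> Ux j; rewrite mxE. Qed.

Lemma divdiff_row_rec c k (x : 'rV[R]_k.+2) : uniq (rowseq x) ->
  divdiff c (rowseq x) = (x ord0 ord_max - x ord0 ord0)^-1 *:
    (divdiff c (rowseq (last_for_first x)) - divdiff c (rowseq (drop_last x))).
Proof.
move=> ux; rewrite -(divdiff_perm _ (permEl (perm_rot 1 (rowseq (last_for_first x))))).
rewrite -rowseq_last_for_first rowseq_drop_last.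
rewrite (divdiff_rem _ ux (j := k)) ?size_rowseq//.
by rewrite -(nth_rowseq x ord_max) -(nth_rowseq x ord0).
Qed.

Lemma is_Ck_quotient U c k : is_Ck U c k.+1 -> is_diff_quotient U
  (iter_diff_quotient U c (k := k)) (iter_diff_quotient U c (k := k.+1)).
Proof. by move=> [_ [g gP]]; apply: xgetPex; exists g. Qed.

(** The defining equation of the iterated quotients is the recursion for divided
    differences, and it applies at every step when the entries are distinct. *)
Lemma iter_diff_quotient_divdiff U c k (x : 'rV[R]_k.+1) : is_Ck U c k ->
  setpow U x -> uniq (rowseq x) -> iter_diff_quotient U c x = divdiff c (rowseq x).
Proof.
elim: k x => [|k IH] x ck Ux ux.
  rewrite -[rowseq x](_ : [:: x ord0 ord0] = _) ?divdiff1//.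
  by rewrite /rowseq enum_ordSl enum_ord0.
(* Distinct entries have in particular different first and last entry. *)
have [_ ->//] := is_Ck_quotient ck; last first.
  rewrite -!nth_rowseq nth_uniq ?size_rowseq//.
case: ck => ck _; rewrite divdiff_row_rec//.
have ul : uniq (rowseq (last_for_first x)).
  rewrite -(rot_uniq 1) -rowseq_last_for_first.
  exact: subseq_uniq (rem_nth_subseq _ _) ux.
have ud : uniq (rowseq (drop_last x)).
  by rewrite rowseq_drop_last; exact: subseq_uniq (rem_nth_subseq _ _) ux.
by rewrite !IH//; [exact: setpow_drop_last|exact: setpow_last_for_first].
Qed.

Lemma iter_diff_quotient_cvg U c k (x : 'rV[R]_k.+1) : is_Ck U c k ->
  setpow U x -> divdiff_cvg U c (rowseq x) (iter_diff_quotient U c x).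
Proof.
move=> ck; apply: continuous_divdiff_cvg; last first.
  by move=> y; exact: iter_diff_quotient_divdiff.
case: k x ck => [|k] x ck; last by case: (is_Ck_quotient ck).
apply/subspace_continuousP => y Uy W.
move/subspace_continuousP : ck => /(_ _ (Uy ord0)) h /h.
rewrite /within /= => /nbhs_ballP[d /= d0 dW]; apply/nbhs_ballP; exists d => //.
by move=> z [_ yz] Uz; apply: dW => //; exact: yz.
Qed.

(** The limits of divided differences define the candidate for the next
    quotient.  Its defining equation, known for distinct entries, extends to all
    tuples with different first and last entry by uniqueness of limits. *)
Lemma diag_cvg_Ck U c k : hausdorff_space E -> accumulating U ->
  (forall j, (j <= k)%N -> diag_cvg U c j) -> is_Ck U c k.
Proof.
move=> hE aU; elim: k => [|k IH] dc /=.
  apply/subspace_continuousP => x Ux W cW.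
  have [L cL] := dc 0%N isT x Ux.
  have xL : L = c x.
    rewrite -(divdiff1 c x); apply: divdiff_cvg_val cL => //.
    by apply/all_in_cons.
  rewrite xL in cL; have [d /= d0 dW] := cL _ cW.
  rewrite /within /=; apply/nbhs_ballP; exists d => // y xy Uy.
  suff : W (divdiff c [:: y]) by rewrite divdiff1.
  apply: dW; split=> //=; first exact/all_in_cons.
  by rewrite andbT.
have ck : is_Ck U c k by apply: IH => j jk; apply: dc; exact: leqW.
split=> //.
have ex (x : 'rV[R]_k.+2) : exists L, setpow U x -> divdiff_cvg U c (rowseq x) L.
  have [Ux|nUx] := pselect (setpow U x); last by exists 0.
  have [||L] := @divdiff_cvg_offdiag _ _ U c (rowseq x) _ _ ((all_in_rowseq U x).2 Ux).
  - by move=> j; rewrite size_rowseq ltnS => /dc.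
  - by rewrite -size_eq0 size_rowseq.
  - by exists L.
have [g gP] := choice ex; exists g; split; first exact: divdiff_cvg_continuous gP.
move=> x Ux x0; apply: (divdiff_cvg_unique hE aU ((all_in_rowseq U x).2 Ux) (gP x Ux)).
have := @iter_diff_quotient_cvg U c k (last_for_first x) ck (setpow_last_for_first Ux).
have := @iter_diff_quotient_cvg U c k (drop_last x) ck (setpow_drop_last Ux).
set D := iter_diff_quotient _ _ _; set L := iter_diff_quotient _ _ _ => hD hL.
have : (fun s => (s`_k.+1 - s`_0)^-1 *:
    (divdiff c (rem_nth 0 s) - divdiff c (rem_nth k.+1 s))) @ tuple_near U (rowseq x) -->
    (x ord0 ord_max - x ord0 ord0)^-1 *: (L - D).
  apply: tvs_cvgZ.
    apply: cvgV; first by rewrite subr_eq0 eq_sym.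
    rewrite -(nth_rowseq x ord_max) -(nth_rowseq x ord0).
    by apply: cvgB; apply: tuple_near_nth; rewrite size_rowseq.
  apply: tvs_cvgD.
    apply: (cvg_comp _ _ (@tuple_near_rem _ U (rowseq x) 0)).
    by rewrite rowseq_last_for_first; exact: divdiff_cvg_rot1.
  rewrite rowseq_drop_last in hD.
  have h1 := cvg_comp _ _ (@tuple_near_rem _ U (rowseq x) k.+1) hD.
  exact: (cvg_comp _ _ h1 (@opp_continuous E D)).
apply: cvg_trans; apply: near_eq_cvg.
near=> s; have [us _ ss] : [/\ uniq s, all_in U s & size s = size (rowseq x)].
  by near: s; exact: tuple_nearE.
by rewrite -divdiff_rem// ss size_rowseq.
Unshelve. all: by end_near. Qed.

End Interface.

(** * Permanence of limits at constant tuples *)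

Section DiagonalLimits.
Context {R : realType} {E : topologicalLmodType R}.
Implicit Types (U : set R) (c : R -> E).

Lemma diag_cvg_eq U c c' k : (forall t, U t -> c' t = c t) ->
  diag_cvg U c k -> diag_cvg U c' k.
Proof.
move=> cc dc a Ua; have [L cL] := dc a Ua; exists L.
by apply: divdiff_cvg_local ltr01 _ cL => t Ut _; split=> //; exact: cc.
Qed.

Lemma diag_cvg_sub U U' c k : U' `<=` U -> diag_cvg U c k -> diag_cvg U' c k.
Proof.
move=> UU dc a Ua; have [L cL] := dc a (UU _ Ua); exists L.
by apply: divdiff_cvg_local ltr01 _ cL => t Ut _; split=> //; exact: UU.
Qed.

Lemma diag_cvg_cst U (v : E) k : diag_cvg U (fun=> v) k.
Proof.
move=> a Ua; case: k => [|k].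
  exists v => W Wv; exists 1; first exact: ltr01.
  move=> s [_ _ /tuple_close_size]; case: s => [|x [|? ?]] // _ /=.
  by rewrite divdiff1; exact: nbhs_singleton.
exists 0 => W W0; exists 1; first exact: ltr01.
move=> s [us _ /tuple_close_size]; rewrite size_nseq => ss.
suff : W (divdiff (fun=> v) s) by [].
by rewrite divdiff_cst ?ss//; exact: nbhs_singleton.
Qed.

Lemma diag_cvgD U c c' k : diag_cvg U c k -> diag_cvg U c' k ->
  diag_cvg U (fun t => c t + c' t) k.
Proof.
move=> dc dc' a Ua; have [L cL] := dc a Ua; have [L' cL'] := dc' a Ua.
exists (L + L'); rewrite /divdiff_cvg.
have -> : divdiff (fun t => c t + c' t) = (fun s => divdiff c s + divdiff c' s).
  by apply/funext => s; rewrite divdiffD.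
exact: tvs_cvgD.
Qed.

Lemma diag_cvg_sum U (I : Type) (r : seq I) (c : I -> R -> E) k :
  (forall i, diag_cvg U (c i) k) -> diag_cvg U (fun t => \sum_(i <- r) c i t) k.
Proof.
move=> dc; elim: r => [|i r IH].
  apply: (@diag_cvg_eq U (fun=> 0)); last exact: diag_cvg_cst.
  by move=> t _; rewrite big_nil.
apply: diag_cvg_eq; last exact: (diag_cvgD (dc i) IH).
by move=> t _; rewrite big_cons.
Qed.

(** Every initial and every final segment of a constant tuple is constant, so
    the Leibniz rule only involves limits at constant tuples. *)
Lemma diag_cvg_mul U (f : R -> R^o) c k :
  (forall j, (j <= k)%N -> diag_cvg U f j) ->
  (forall j, (j <= k)%N -> diag_cvg U c j) ->
  diag_cvg U (fun t => f t *: c t) k.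
Proof.
move=> df dc a Ua.
have exf (j : 'I_k.+1) : exists L, divdiff_cvg U f (nseq j.+1 a) L.
  by apply: df => //; rewrite -ltnS.
have exc (j : 'I_k.+1) : exists L, divdiff_cvg U c (nseq (k.+1 - j) a) L.
  by rewrite subSn; [apply: dc => //; exact: leq_subr|rewrite -ltnS].
have [lf flf] := choice exf; have [lc clc] := choice exc.
exists (\sum_(j <- enum 'I_k.+1) (lf j : R) *: lc j).
have : (fun s => \sum_(j <- enum 'I_k.+1) (divdiff f (take j.+1 s) : R) *: divdiff c (drop j s))
    @ tuple_near U (nseq k.+1 a) --> \sum_(j <- enum 'I_k.+1) (lf j : R) *: lc j.
  apply: tvs_cvg_sum => j; apply: tvs_cvgZ.
    apply: (cvg_comp _ _ (@tuple_near_take _ U (nseq k.+1 a) j.+1)).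
    by rewrite take_nseq//; exact: flf.
  apply: (cvg_comp _ _ (@tuple_near_drop _ U (nseq k.+1 a) j)).
  by rewrite drop_nseq; exact: clc.
apply: cvg_trans; apply: near_eq_cvg.
near=> s; have [us _] : [/\ uniq s, all_in U s & size s = size (nseq k.+1 a)].
  by near: s; exact: tuple_nearE.
rewrite size_nseq => ss.
by rewrite divdiff_leibniz// ss big_enum.
Unshelve. all: by end_near. Qed.

Lemma diag_cvg_affine (a b : R) c k : a != 0 -> diag_cvg [set: R] c k ->
  diag_cvg [set: R] (fun t => c (a * t + b)) k.
Proof.
move=> a0 dc x _; have [L cL] := dc (a * x + b) I.
exists (a ^+ k *: L).
have : (fun s => a ^+ k *: divdiff c [seq a * t + b | t <- s]) @
    tuple_near [set: R] (nseq k.+1 x) --> a ^+ k *: L.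
  apply: tvs_cvgZ; first exact: cvg_cst.
  apply: cvg_comp cL => A [d d0 dA].
  exists (d / `|a|); first by rewrite /= divr_gt0// normr_gt0.
  move=> s [us _ /tuple_close_nseqP [ss sx]]; apply: dA; split=> //.
    by rewrite map_inj_uniq// => t u /addIr /(mulfI a0).
  apply/tuple_close_nseqP; rewrite size_map; split=> // _ /mapP[t ts ->].
  rewrite opprD addrACA subrr addr0 -mulrBr normrM mulrC.
  by rewrite -ltr_pdivlMr ?normr_gt0//; exact: sx.
apply: cvg_trans; apply: near_eq_cvg.
near=> s; have [us _] : [/\ uniq s, all_in setT s & size s = size (nseq k.+1 x)].
  by near: s; exact: tuple_nearE.
rewrite size_nseq => ss.
by rewrite divdiff_affine// ss.
Unshelve. all: by end_near. Qed.

End DiagonalLimits.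

(** * Boundedness of divided differences *)

Section Bounded.
Context {R : realType} {E : topologicalLmodType R}.
Implicit Types (U : set R) (c : R -> E) (q : E -> R).

Lemma perm_to_rem2 (x y : R) s : x \in s -> y \in s -> x != y ->
  perm_eq s [:: x, y & rem y (rem x s)].
Proof.
move=> xs ys xy; apply: perm_trans (perm_to_rem xs) _; rewrite perm_cons.
apply: perm_to_rem; have := perm_mem (perm_to_rem xs) y.
by rewrite ys inE eq_sym (negPf xy).
Qed.

(** The recursion as an estimate: two nodes at distance at least [d] reduce the
    order by one at the cost of a factor [2 / d] and a change of gauge. *)
Lemma gauge_divdiff_rec q q' c (x y d M : R) s :
  is_gauge q -> (forall u v, q (u + v) <= q' u + q' v) -> is_gauge q' ->
  uniq s -> x \in s -> y \in s -> 0 < d -> d <= `|x - y| ->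
  (forall s', subseq s' s -> (size s').+1 = size s -> q' (divdiff c s') <= M) ->
  q (divdiff c s) <= d^-1 * (M *+ 2).
Proof.
move=> [q0 qZ _] qq' [_ q'Z _] us xs ys d0 dxy h.
have xy : x != y by apply: contraTneq dxy => ->; rewrite subrr normr0 -ltNge.
have p := perm_to_rem2 xs ys xy; have u2 := us; rewrite (perm_uniq p) in u2.
have yx0 : y - x != 0 by rewrite subr_eq0 eq_sym.
have -> : divdiff c s = (y - x)^-1 *:
    (divdiff c (y :: rem y (rem x s)) - divdiff c (x :: rem y (rem x s))).
  apply: (scalerI yx0); rewrite scalerA divff// scale1r.
  by rewrite (divdiff_perm _ p) divdiff_rec.
have M0 t : t \in s -> q' (divdiff c (rem t s)) <= M.
  by move=> ts; apply: h; [exact: rem_subseq|rewrite size_rem// prednK//; case: (s) ts].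
have ex : q' (divdiff c (y :: rem y (rem x s))) <= M.
  rewrite (@divdiff_perm _ _ c _ (rem x s)); first exact: M0.
  rewrite perm_sym; apply: perm_to_rem.
  by have := perm_mem (perm_to_rem xs) y; rewrite ys inE eq_sym (negPf xy).
have ey : q' (divdiff c (x :: rem y (rem x s))) <= M.
  rewrite (@divdiff_perm _ _ c _ (rem y s)); first exact: M0.
  rewrite -(perm_cons y); apply: perm_trans (perm_to_rem ys).
  by rewrite perm_sym (perm_trans p)// (perm_catCA [:: x] [:: y]).
rewrite qZ normfV distrC mulr2n; apply: ler_pM.
- by rewrite invr_ge0.
- exact: q0.
- by rewrite lef_pV2// posrE// normr_gt0 subr_eq0.
- apply: le_trans (qq' _ _) _; apply: lerD => //.
  by rewrite -scaleN1r q'Z normrN1 mul1r.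
Qed.

(** Near each tuple the divided differences are bounded since they converge
    there; finitely many of these neighbourhoods cover a compact box. *)
Lemma gauge_divdiff_compact q c k (A B : R) : is_gauge q ->
  (forall j, diag_cvg [set: R] c j) ->
  exists M, forall s, uniq s -> size s = k.+1 -> all_in `[A, B] s ->
    q (divdiff c s) <= M.
Proof.
move=> gq dc; have [q' gq' qq'] := gauge_add gq.
have K : compact [set v : 'rV[R]_k.+1 | forall i, `[A, B]%classic (v ord0 i)].
  by apply: (@rV_compact R k.+1 (fun=> `[A, B]%classic)) => i; exact: segment_compact.
move/compact_near_coveringP : K => /(_ nat \oo
  (fun N x => uniq (rowseq x) -> q (divdiff c (rowseq x)) <= N%:R) _).
have cov (x : 'rV[R]_k.+1) : \forall x' \near x & N \near \oo,
    uniq (rowseq x') -> q (divdiff c (rowseq x')) <= N%:R.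
  have [|||L cL] := @divdiff_cvg_offdiag _ _ setT c (rowseq x) => //.
    by rewrite -size_eq0 size_rowseq.
  have nL : nbhs L [set y | q' (y - L) < 1].
    apply/nbhs_translate; apply: filterS (gauge_lt gq' ltr01) => z /=.
    by rewrite addrC addKr.
  have [d /= d0 dL] := cL _ nL.
  exists ([set y | ball x d y], [set N | q' L + 1 <= N%:R]).
    split; first exact: nbhsx_ballx.
    exact: nbhs_infty_ger.
  move=> [y N] /= [xy LN] uy; apply: le_trans LN.
  rewrite -(subrK L (divdiff c (rowseq y))) addrC; apply: le_trans (qq' _ _) _.
  rewrite lerD2l ltW//; apply: dL; split => //.
  exact/tuple_close_rowseq.
move=> /(_ (fun x _ => cov x)) [N _ /(_ N (leqnn N)) h].
exists N%:R => s us ss sAB; rewrite -(seqrowK ss); apply: h.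
  by apply/all_in_rowseq; rewrite seqrowK.
by rewrite seqrowK.
Qed.

(** A tuple outside [[A - 1, B + 1]] has only nodes where [c] takes the same
    constant value, or has two nodes at distance at least 1. *)
Lemma gauge_divdiff_bounded q c k (A B : R) (v w : E) : is_gauge q ->
  (forall j, diag_cvg [set: R] c j) ->
  (forall t, t <= A -> c t = v) -> (forall t, B <= t -> c t = w) ->
  exists M, forall s, uniq s -> size s = k.+1 -> q (divdiff c s) <= M.
Proof.
move=> gq dc cv cw; elim: k q gq => [|k IH] q gq.
  have [M hM] := gauge_divdiff_compact 0 A B gq dc.
  exists (Num.max M (Num.max (q v) (q w))) => -[|x [|? ?]]// _ _.
  rewrite divdiff1 !le_max; have [xA|Ax] := leP x A; first by rewrite cv// lexx orbT.
  have [Bx|xB] := leP B x; first by rewrite cw// lexx !orbT.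
  by rewrite -(divdiff1 c x) hM// => y; rewrite inE => /eqP ->; rewrite /= in_itv /= !ltW.
have [q' gq' qq'] := gauge_add gq; have [M' hM'] := IH q' gq'.
have [M hM] := gauge_divdiff_compact k.+1 (A - 1) (B + 1) gq dc.
exists (Num.max M (Num.max 0 (M' *+ 2))) => s us ss; rewrite !le_max.
have far x y : x \in s -> y \in s -> 1 <= `|x - y| -> q (divdiff c s) <= M' *+ 2.
  move=> xs ys xy; rewrite -[leRHS]mul1r -invr1.
  apply: (gauge_divdiff_rec gq qq' gq' us xs ys ltr01 xy) => s' s's.
  by rewrite ss => -[/hM']; apply; exact: subseq_uniq s's us.
have cst u : (forall x, x \in s -> c x = u) -> q (divdiff c s) <= 0.
  by move=> h; rewrite (@eq_divdiff _ _ _ (fun=> u))// divdiff_cst ?ss// gauge0.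
have [/allP h|/allPn[x xs xAB]] := boolP (all (mem `[A - 1, B + 1]) s).
  by rewrite hM// => x /h.
(* [x] is beyond one of the ends: either all nodes are beyond [A], or
   beyond [B], or some node is at distance more than 1 from [x]. *)
have [x_A|A_x] := ltP x (A - 1).
  have [/allP h|/allPn[y ys yA]] := boolP (all (fun y => y <= A) s).
    by rewrite (cst v) ?orbT// => y /h /cv.
  rewrite (far y x) ?orbT//; rewrite -ltNge in yA.
  by apply: le_trans (ler_norm _); lra.
have Bx : B + 1 < x.
  by move: xAB; rewrite /= in_itv /= A_x /= -ltNge.
have [/allP h|/allPn[y ys yA]] := boolP (all (fun y => B <= y) s).
  by rewrite (cst w) ?orbT// => y /h /cw.
rewrite (far x y) ?orbT//; rewrite -ltNge in yA.
by apply: le_trans (ler_norm _); lra.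
Qed.

Lemma BCinfty_diag c (A B : R) : hausdorff_space E ->
  accumulating [set: R] ->
  (forall j, diag_cvg [set: R] c j) ->
  (forall t, t <= A -> c t = 0) -> (forall t, B <= t -> c t = 0) ->
  is_BCinfty [set: R] c.
Proof.
move=> hE aT dc cA cB; have ck k : is_Ck [set: R] c k by exact: diag_cvg_Ck.
split=> // k; apply: tvs_boundedP => q gq.
have [q' gq' qq'] := gauge_add gq.
have [M hM] := gauge_divdiff_bounded k gq' dc cA cB.
exists (M + 1) => _ [x _ <-].
have aTx : all_in [set: R] (rowseq x) by [].
have := iter_diff_quotient_cvg (ck k) (fun i => I : setT (x ord0 i)).
set L := iter_diff_quotient _ _ _ => cL.
have nL : nbhs L [set y | q' (L - y) < 1].
  apply/nbhs_translate; have := @opp_continuous E 0; rewrite /continuous_at oppr0.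
  move=> /(_ _ (gauge_lt gq' ltr01)); apply: (@filterS _ (nbhs (0 : E))) => z /=.
  by rewrite opprD addNKr.
have Px := tuple_near_proper aT aTx.
have /filter_ex[s [Ls [us _ ss]]] : \forall s \near tuple_near setT (rowseq x),
    q' (L - divdiff c s) < 1 /\ [/\ uniq s, all_in setT s & size s = size (rowseq x)].
  apply: filterI; first exact: (cL _ nL).
  exact: tuple_nearE.
rewrite -(subrK (divdiff c s) L) addrC; apply: le_trans (qq' _ _) _.
by apply: lerD; [apply: hM => //; rewrite ss size_rowseq|exact: ltW].
Qed.

End Bounded.

(** * Lagrange interpolation *)

Section Interpolation.
Context {K : fieldType}.
Implicit Types (f : K -> K) (s : seq K).

(** The interpolation polynomial of [f] at the nodes [s]; its top coefficient is
    the divided difference. *)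
Definition lagrange f s : {poly K} :=
  \sum_(x <- s) ((\prod_(y <- s | y != x) (x - y))^-1 * f x) *:
    \prod_(y <- s | y != x) ('X - y%:P).

Lemma size_lagrange_basis s x : uniq s -> x \in s ->
  size (\prod_(y <- s | y != x) ('X - y%:P)) = size s.
Proof.
move=> us xs; rewrite -big_filter size_prod_XsubC size_filter.
by rewrite -(count_predC (pred1 x) s) count_uniq_mem// xs.
Qed.

Lemma size_lagrange f s : uniq s -> (size (lagrange f s) <= size s)%N.
Proof.
move=> us; apply: leq_trans (size_sum _ _ _) _.
apply/bigmax_leqP_seq => x xs _; apply: leq_trans (size_scale_leq _ _) _.
by rewrite size_lagrange_basis.
Qed.

Lemma lagrange_val f s x : uniq s -> x \in s -> (lagrange f s).[x] = f x.
Proof.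
move=> us xs; rewrite horner_sum (bigD1_seq x)//= [X in _ + X]big1_seq ?addr0.
  rewrite hornerZ horner_prod mulrAC.
  rewrite [X in _ * X * _](eq_bigr (fun y => x - y)) => [|y _]; last exact: hornerXsubC.
  rewrite mulVf ?mul1r// prodf_seq_neq0; apply/allP => y ys.
  by apply/implyP; rewrite subr_eq0 eq_sym.
move=> y /andP[yx ys]; rewrite hornerZ horner_prod.
apply/eqP; rewrite mulf_eq0; apply/orP; right.
rewrite prodf_seq_eq0; apply/hasP; exists x => //.
by rewrite eq_sym yx hornerXsubC subrr /=.
Qed.

Lemma coef_lagrange f s : uniq s -> (lagrange f s)`_(size s).-1 = divdiff (f : K -> K^o) s.
Proof.
move=> us; rewrite coef_sum; apply: eq_big_seq => x xs.
rewrite coefZ -[in X in _ * X](size_lagrange_basis us xs) -lead_coefE.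
by rewrite (monicP _) ?mulr1// -big_filter monic_prod_XsubC.
Qed.

Lemma divdiff_poly (p : {poly K}) s : uniq s -> (size p <= size s)%N ->
  divdiff (horner p : K -> K^o) s = p`_(size s).-1.
Proof.
move=> us ps; suff e : lagrange (horner p) s = p by rewrite -coef_lagrange ?e.
apply: subr0_eq; apply: (@roots_geq_poly_eq0 _ _ s) => //; last first.
  by rewrite (leq_trans (size_polyD _ _))// geq_max size_lagrange//= size_polyN.
by apply/allP => x xs; rewrite rootE hornerD hornerN lagrange_val// subrr.
Qed.

End Interpolation.

(** * A mean value theorem for divided differences *)

Section MeanValue.
Context {R : realType}.
Implicit Types (F G : R -> R) (s : seq R).

(** Rolle's theorem between consecutive zeros. *)
Lemma rolle_seq F G s (x : R) : (forall t : R, is_derive t 1 F (G t)) ->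
  path <%R x s -> F x = 0 -> (forall y, y \in s -> F y = 0) ->
  exists s', [/\ size s' = size s, path <%R x s', forall y, y \in s' -> G y = 0 &
                 forall y, y \in s' -> y <= last x s].
Proof.
move=> FG; elim: s x => [|y s IH] x /=; first by exists [::].
move=> /andP[xy ys] Fx0 Fs0.
have [s' [ss ps Gs ls]] := IH y ys (Fs0 _ (mem_head _ _))
  (fun z zs => Fs0 z (@mem_behead _ (y :: s) z zs)).
have [|||c] := Rolle xy (f := F).
- by move=> t _; case: (FG t).
- by apply: derivable_within_continuous => t _; case: (FG t).
- by rewrite Fx0 Fs0 ?mem_head.
rewrite in_itv /= => /andP[xc cy] Fc.
have Gc : G c = 0.
  by rewrite -(@derive_val _ _ _ _ _ _ _ (FG c)) (@derive_val _ _ _ _ _ _ _ Fc).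
exists (c :: s'); split=> /=; first by rewrite ss.
- by rewrite xc; apply: path_le ps => //; exact: lt_trans.
- by move=> z; rewrite inE => /predU1P[->//|/Gs].
- move=> z; rewrite inE => /predU1P[->|/ls//].
  apply: le_trans (ltW cy) _.
  have := order_path_min lt_trans ys => /allP h.
  by have := mem_last y s; rewrite inE => /predU1P[->//|/h/ltW].
Qed.

(** Subtract from [F] its interpolation polynomial [L] at the nodes and apply
    Rolle: at the new nodes [G] agrees with the derivative of [L], whose top
    coefficient is [k + 1] times that of [L].  The condition on [a] and [d] says
    that the new nodes lie in the hull of the old ones. *)
Lemma divdiff_mean_value F G k s : (forall t : R, is_derive t 1 F (G t)) ->
  uniq s -> size s = k.+2 -> exists s',
  [/\ uniq s', size s' = k.+1,
      forall (a d : R), (forall y, y \in s -> `|a - y| < d) ->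
                        (forall y, y \in s' -> `|a - y| < d) &
      divdiff (F : R -> R^o) s = k.+1%:R^-1 *: divdiff (G : R -> R^o) s'].
Proof.
move=> FG us0 ss0; pose s1 := sort <=%R s.
have ps1 : perm_eq s1 s by rewrite perm_sort.
rewrite -(divdiff_perm _ ps1); have us := us0; rewrite -(perm_uniq ps1) in us.
have ss := ss0; rewrite -(perm_size ps1) in ss.
have ms y : (y \in s) = (y \in s1) by rewrite (perm_mem ps1).
have : sorted <%R s1 by rewrite sort_lt_sorted.
move: s1 us ss ms {ps1} => [|x s1] // us ss ms /= xs1.
pose L := lagrange F (x :: s1).
have FL (t : R) : is_derive t 1 (fun t : R => F t - L.[t]) (G t - L^`().[t]).
  have dL : is_derive t 1 (horner L) (L^`().[t]).
    rewrite derivE derive1E; apply: derivableP; exact: derivable_horner.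
  exact: is_deriveB.
have L0 y : y \in x :: s1 -> F y - L.[y] = 0.
  by move=> ys; rewrite lagrange_val// subrr.
have [s' [ss' xs' Gs' ls']] := rolle_seq FL xs1 (L0 _ (mem_head _ _))
  (fun z zs => L0 z (@mem_behead _ (x :: s1) z zs)).
have us' : uniq s' by apply: (sorted_uniq lt_trans) => //; exact: path_sorted xs'.
have sk : size s' = k.+1 by rewrite ss'; case: ss.
exists s'; split=> //.
  move=> a d h y ys'.
  have xy : x < y by move/(order_path_min lt_trans): xs' => /allP /(_ y ys').
  have yl := ls' y ys'.
  have := h x; rewrite ms mem_head => /(_ isT).
  have := h (last x s1); rewrite ms mem_last => /(_ isT).
  by rewrite !ltr_norml; lra.
have -> : divdiff (G : R -> R^o) s' = divdiff (horner L^`() : R -> R^o) s'.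
  by apply: eq_divdiff => y /Gs' /eqP; rewrite subr_eq0 => /eqP.
have sL : (size L <= k.+2)%N by rewrite -ss; exact: size_lagrange.
rewrite divdiff_poly// ?sk; last first.
  by apply: leq_trans (size_poly _ _) _; move: sL; case: (size L).
rewrite coef_deriv -coef_lagrange// ss /= -/L -[X in _ = _ *: X]mulr_natl /GRing.scale /=.
by rewrite mulrA mulVf ?mul1r// pnatr_eq0.
Qed.

Lemma diag_cvg_primitive F G k : (forall t : R, is_derive t 1 F (G t)) ->
  diag_cvg [set: R] (G : R -> R^o) k -> diag_cvg [set: R] (F : R -> R^o) k.+1.
Proof.
move=> FG dG a _; have [L cL] := dG a I; exists (k.+1%:R^-1 *: L).
have h : (fun s => k.+1%:R^-1 *: divdiff (G : R -> R^o) s) @ tuple_near setT (nseq k.+1 a)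
    --> k.+1%:R^-1 *: L by apply: tvs_cvgZ => //; exact: cvg_cst.
move=> W /h [d d0 dW]; exists d => // s [us _ /tuple_close_nseqP [ss sa]].
have [s' [us' ss' sa' e]] := divdiff_mean_value FG us ss.
suff : W (divdiff (F : R -> R^o) s) by [].
rewrite e; apply: dW; split => //; apply/tuple_close_nseqP; split=> //.
exact: sa'.
Qed.

End MeanValue.

(** * A smooth step function *)

Section SmoothStep.
Context {R : realType}.
Implicit Types (F G : R -> R^o).

(** Solve the Leibniz rule for [F * F^-1 = 1] for the divided difference of
    [F^-1] of highest order, whose factor is a value of [F]. *)
Lemma diag_cvg_inv F k : (forall j, diag_cvg [set: R] F j) -> (forall t, F t != 0) ->
  diag_cvg [set: R] (fun t => (F t : R)^-1 : R^o) k.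
Proof.
move=> dF F0; set G := (fun t => (F t : R)^-1 : R^o).
elim/ltn_ind: k => k IH a _.
have [L0 FL0] := dF 0%N a I.
have L0E : L0 = F a.
  rewrite -(divdiff1 F a); apply: (divdiff_cvg_val _ _ _ FL0) => //.
have [M0 FM0] := @diag_cvg_cst R R^o setT (1 : R^o) k a I.
have exf (j : 'I_k) : exists L, divdiff_cvg setT F (nseq j.+2 a) L by exact: dF.
have exg (j : 'I_k) : exists L, divdiff_cvg setT G (nseq (k - j) a) L.
  have jk : (k - j.+1 < k)%N by rewrite ltn_subrL/=; case: (k) j => [[]|].
  have [L] := IH _ jk a I; rewrite subnSK//; by exists L.
have [lf flf] := choice exf; have [lg glg] := choice exg.
exists ((L0 : R)^-1 *: (M0 - \sum_(j <- enum 'I_k) (lf j : R) *: lg j)).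
have : (fun s => (divdiff F (take 1 s) : R)^-1 *: (divdiff (fun=> 1 : R^o) s -
    \sum_(j <- enum 'I_k) (divdiff F (take j.+2 s) : R) *: divdiff G (drop j.+1 s)))
    @ tuple_near setT (nseq k.+1 a) -->
    (L0 : R)^-1 *: (M0 - \sum_(j <- enum 'I_k) (lf j : R) *: lg j).
  apply: tvs_cvgZ.
    apply: cvgV; first by rewrite L0E.
    apply: (cvg_comp _ _ (@tuple_near_take _ setT (nseq k.+1 a) 1)).
    by rewrite take_nseq.
  apply: cvgB; first exact: FM0.
  apply: tvs_cvg_sum => j; apply: tvs_cvgZ.
    apply: (cvg_comp _ _ (@tuple_near_take _ setT (nseq k.+1 a) j.+2)).
    by rewrite take_nseq ?ltnS//; exact: flf.
  apply: (cvg_comp _ _ (@tuple_near_drop _ setT (nseq k.+1 a) j.+1)).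
  by rewrite drop_nseq subSS; exact: glg.
apply: cvg_trans; apply: near_eq_cvg.
near=> s; have [us _] : [/\ uniq s, all_in setT s & size s = size (nseq k.+1 a)].
  by near: s; exact: tuple_nearE.
rewrite size_nseq => ss.
have -> : divdiff (fun=> 1 : R^o) s = divdiff (fun t => (F t : R) *: G t) s.
  by apply: eq_divdiff => t _; rewrite /G /GRing.scale /= divff.
rewrite divdiff_leibniz// ss big_ord_recl /= drop0 big_enum /=.
have F1 : (divdiff F (take 1 s) : R) != 0.
  by case: (s) ss => // x s' _ /=; rewrite take0 divdiff1.
apply: (@etrans _ _ ((divdiff F (take 1 s) : R)^-1 *: ((divdiff F (take 1 s) : R) *: divdiff G s))).
  by congr (_ *: _); exact: addrK.
by rewrite scalerA mulVf// scale1r.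
Unshelve. all: by end_near. Qed.

(** The family is closed under derivatives up to linear combinations, which
    makes smoothness an induction on the order. *)
Definition flat (m : nat) (x : R) : R :=
  if 0 < x then x^-1 ^+ m * expR (- x^-1) else 0.

(** With [u = x^-1], this is [u ^ (m + 1) / (m + 1)! <= exp u]. *)
Lemma flat_le m x : 0 < x -> flat m x <= (m.+1)`!%:R * x.
Proof.
move=> x0; rewrite /flat x0; have := expR_ge1Dxn m (ltW (_ : 0 < x^-1)).
rewrite invr_gt0 => /(_ x0) h.
rewrite expRN.
have f0 : (0 : R) < (m.+1)`!%:R by rewrite ltr0n fact_gt0.
have u0 : 0 < x^-1 by rewrite invr_gt0.
rewrite ler_pdivrMr ?expR_gt0//.
apply: (@le_trans _ _ ((m.+1)`!%:R * x * (1 + x^-1 ^+ m.+1 / (m.+1)`!%:R))); last first.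
  by rewrite ler_pM2l// mulr_gt0.
rewrite mulrDr mulr1 -[leLHS]add0r lerD//; first by rewrite mulr_ge0// ltW.
rewrite exprS; set u := x^-1 ^+ m; set f := _%:R in f0 *.
have -> : f * x * (x^-1 * u / f) = (f / f) * (x / x) * u by field; lra.
by rewrite !divff ?mul1r// lt0r_neq0.
Qed.

Lemma flat_ge0 m x : 0 <= flat m x.
Proof.
rewrite /flat; case: ifP => // x0.
by rewrite mulr_ge0 ?expR_ge0// exprn_ge0// invr_ge0 ltW.
Qed.

Lemma is_derive_flat m (x : R) :
  is_derive x 1 (flat m) (flat m.+2 x - m%:R * flat m.+1 x).
Proof.
have [x0|x0|x0] := ltgtP x 0.
- have -> : flat m.+2 x - m%:R * flat m.+1 x = 0.
    by rewrite /flat ltNge (ltW x0) /= mulr0 subrr.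
  apply: (@near_eq_is_derive _ R R (cst 0)).
  near=> y; rewrite /flat ltNge ifN// negbK ltW//.
  near: y; exact: lt_nbhsl.
- have xN0 : x != 0 by rewrite gt_eqF.
  have dV : is_derive x 1 (fun y : R => y^-1) (- x ^- 2 *: 1).
    exact: (is_deriveV xN0 (is_derive_id x 1)).
  have dX := is_deriveX m dV.
  have dE := @is_derive1_comp R expR (- (fun y : R => y^-1)) x _ _
    (is_derive_expR _) (is_deriveN dV).
  have dM := is_deriveM dX dE.
  apply: (@near_eq_is_derive _ R R (((fun y : R => y^-1) ^+ m) *
      (expR \o - (fun y : R => y^-1)))).
    near=> y; rewrite /flat ifT; last by near: y; exact: lt_nbhsr.
    by rewrite /= !fctE.
  apply: (is_derive_eq dM); rewrite /flat x0 !fctE /= /GRing.scale /= !mulr1.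
  case: m dX dM => [|m] _ _; rewrite ?mul0r ?expr0 /= !exprS; field; lra.
- rewrite x0 /flat ltxx mulr0 subrr.
  have cv : h^-1 *: (flat m (h *: 1 + 0) - flat m 0) @[h --> (0 : R)^'] --> (0 : R).
    apply/cvgr0Pnorm_lt => e e0.
    near=> h; have h0 : h != 0 by near: h; exact: nbhs_dnbhs_neq.
    rewrite /flat ltxx subr0 addr0 /GRing.scale /= mulr1.
    case: ifP => hp; last by rewrite mulr0 normr0.
    have -> : h^-1 * (h^-1 ^+ m * expR (- h^-1)) = flat m.+1 h.
      by rewrite /flat hp exprS mulrA.
    rewrite ger0_norm ?flat_ge0//; apply: le_lt_trans (flat_le _ hp) _.
    have f0 : (0 : R) < (m.+2)`!%:R by rewrite ltr0n fact_gt0.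
    rewrite mulrC -ltr_pdivlMr// -[ltLHS]gtr0_norm//.
    by near: h; apply: dnbhs0_lt; rewrite divr_gt0.
  apply: DeriveDef; first by apply/cvg_ex; exists 0.
  exact: cvg_lim cv.
Unshelve. all: by end_near. Qed.

Lemma diag_cvg_continuous (F : R -> R^o) : continuous F -> diag_cvg [set: R] F 0.
Proof.
move=> cF a _; exists (F a) => W /(cF a) /nbhs_ballP[d /= d0 dW].
exists d => // s [_ _ sa]; have := tuple_close_size sa.
case: s sa => [|x [|? ?]] //= /andP[ax _] _.
by suff : W (divdiff F [:: x]) by []; rewrite divdiff1; apply: dW.
Qed.

Lemma diag_cvg_flat m k : diag_cvg [set: R] (flat m : R -> R^o) k.
Proof.
elim/ltn_ind: k m => -[_|k IH] m.
  apply: diag_cvg_continuous => x; apply: differentiable_continuous.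
  by apply/derivable1_diffP; case: (is_derive_flat m x).
apply: diag_cvg_primitive; first exact: is_derive_flat.
apply: (@diag_cvgD _ R^o); first exact: IH.
apply: (@diag_cvg_eq _ R^o _ (fun t => (- m%:R : R^o) *: flat m.+1 t)).
  by move=> t _; rewrite scaleNr.
apply: (@diag_cvg_mul _ R^o _ (fun=> - m%:R)) => j jk; first exact: diag_cvg_cst.
by apply: IH; rewrite ltnS.
Qed.

(** The usual quotient [flat 0 t / (flat 0 t + flat 0 (1 - t))]. *)
Lemma smooth_step : exists f : R -> R^o,
  [/\ forall k, diag_cvg [set: R] f k, forall t, t <= 0 -> f t = 0,
      forall t, 1 <= t -> f t = 1 & forall t, (0 : R) <= f t <= 1].
Proof.
pose g (t : R) : R := flat 0 t + flat 0 (- 1 * t + 1).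
have flat0 (t : R) : t <= 0 -> flat 0 t = 0 by move=> t0; rewrite /flat ltNge t0.
have flat1 (t : R) : 0 < t -> 0 < flat 0 t.
  by move=> t0; rewrite /flat t0 expr0 mul1r expR_gt0.
have g0 t : 0 < g t.
  have [t0|t0] := ltP 0 t.
    by rewrite ltr_wpDr ?flat_ge0// flat1.
  by rewrite ltr_wpDl ?flat_ge0// flat1//; lra.
exists (fun t => flat 0 t *: ((g t)^-1 : R^o)); split=> [k|t t0|t t1|t].
- apply: (@diag_cvg_mul _ R^o) => j _; first exact: diag_cvg_flat.
  apply: diag_cvg_inv => [i|t]; last by rewrite gt_eqF.
  apply: (@diag_cvgD _ R^o); first exact: diag_cvg_flat.
  apply: (@diag_cvg_affine _ R^o (- 1) 1); first by rewrite oppr_eq0 oner_eq0.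
  exact: diag_cvg_flat.
- by rewrite flat0// scale0r.
- have e : flat 0 (- 1 * t + 1) = 0 by apply: flat0; lra.
  have := g0 t; rewrite /g e addr0 => gt0.
  by rewrite /GRing.scale /= divff// gt_eqF.
- rewrite /GRing.scale /= divr_ge0 ?flat_ge0 ?(ltW (g0 t))//=.
  by rewrite ler_pdivrMr// mul1r lerDl flat_ge0.
Qed.

End SmoothStep.

(** * Rapidly decaying sequences of curves *)

Section Rapid.
Context {R : realType} {E : topologicalLmodType R}.
Implicit Types (U : nat -> set R) (g : nat -> R -> E) (h : nat -> R -> R^o).

(** The divided differences of [g n] on [U n] decay faster than every power of
    [n].  Bounds by 1 suffice, as the power [l] is arbitrary. *)
Definition rapid U g := forall (q : E -> R) k l, is_gauge q ->
  \forall n \near \oo, forall s, uniq s -> size s = k.+1 -> all_in (U n) s ->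
    n%:R ^+ l * q (divdiff (g n) s) <= 1.

(** At most polynomial growth in [n], which products with a rapidly decaying
    sequence absorb. *)
Definition moderate h := forall k, exists l, \forall n \near \oo,
  forall s, uniq s -> size s = k.+1 -> `|divdiff (h n) s : R| <= n%:R ^+ l.

Lemma rapid_mul U h g : moderate h -> rapid U g ->
  rapid U (fun n t => h n t *: g n t).
Proof.
move=> mh rg q k l gq; have [q' gq' qq'] := gauge_sum k gq.
have [p hp] := choice mh.
have H1 : \forall n \near \oo, forall j : 'I_k.+1, forall s, uniq s -> size s = j.+1 ->
    `|divdiff (h n) s : R| <= n%:R ^+ p j.
  by apply: filter_forall => j; exact: hp.
have H2 : \forall n \near \oo, forall j : 'I_k.+1, forall s, uniq s ->
    size s = (k - j).+1 -> all_in (U n) s ->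
    n%:R ^+ (l + p j).+1 * q' (divdiff (g n) s) <= 1.
  by apply: filter_forall => j; exact: rg.
near=> n => s us ss Us.
have nk : (k.+1 <= n)%N by near: n; exact: nbhs_infty_ge.
have n0 : (0 : R) < n%:R by rewrite ltr0n; apply: leq_trans nk.
rewrite divdiff_leibniz// ss -big_enum /=.
apply: (@le_trans _ _ (n%:R ^+ l * \sum_(j <- enum 'I_k.+1)
    q' (divdiff (h n) (take j.+1 s) *: divdiff (g n) (drop j s)))).
  rewrite ler_pM2l ?exprn_gt0//; apply: qq'.
  by rewrite -cardE card_ord.
rewrite mulr_sumr; apply: (@le_trans _ _ (\sum_(j <- enum 'I_k.+1) n%:R^-1)).
  apply: ler_sum => j _; case: (gq') => q'0 q'Z _; rewrite q'Z.
  have jk : (j <= k)%N by rewrite -ltnS.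
  have ht : `|divdiff (h n) (take j.+1 s) : R| <= n%:R ^+ p j.
    by apply: (near H1 n) => //; [exact: take_uniq|rewrite size_takel// ss].
  have gd : n%:R ^+ (l + p j).+1 * q' (divdiff (g n) (drop j s)) <= 1.
    apply: (near H2 n) => //; first exact: drop_uniq.
      by rewrite size_drop ss subSn.
    by move=> x /mem_drop; exact: Us.
  apply: (@le_trans _ _ (n%:R ^+ l * (n%:R ^+ p j * q' (divdiff (g n) (drop j s))))).
    by rewrite ler_pM2l ?exprn_gt0//; apply: ler_wpM2r.
  by rewrite -[leRHS]mul1r ler_pdivlMr// mulrA -exprD mulrC mulrA -exprS.
by rewrite big_enum sumr_const card_ord -[leLHS]mulr_natl ler_pdivrMr// mul1r ler_nat.
Unshelve. all: by end_near. Qed.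

(** The hypothesis says that a node outside [U n] is at distance at least
    [n ^ - 2] from every node where [g n] does not vanish.  A tuple that is not
    inside [U n] therefore has divided difference 0, or its order can be reduced
    at the cost of the factor [2 n ^ 2]. *)
Lemma rapid_extend U g : rapid U g ->
  (\forall n \near \oo, forall x y, ~ U n x -> g n y != 0 -> n%:R ^- 2 <= `|x - y|) ->
  rapid (fun=> setT) g.
Proof.
move=> rg gap q k; elim: k q => [|k IH] q l gq.
  near=> n => s us ss _.
  have n0 : (0 : R) < n%:R by rewrite ltr0n; near: n; exact: nbhs_infty_gt.
  case: s us ss => [|x [|? ?]]// us _.
  (* A single node outside [U n] with [g n x != 0] would be at distance 0 from
     itself. *)
  have [Ux|nUx] := pselect (U n x).
    by apply: (near (rg q 0%N l gq) n) => //; exact/all_in_cons.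
  have [gx|gx] := eqVneq (g n x) 0; first by rewrite divdiff1 gx (gauge0 gq) mulr0 ler01.
  have : n%:R ^- 2 <= `|x - x| by apply: (near gap n).
  by rewrite subrr normr0 leNgt invr_gt0 exprn_gt0.
have [q' gq' qq'] := gauge_add gq.
near=> n => s us ss _.
have n2 : (2 : R) <= n%:R by near: n; exact: nbhs_infty_ger.
have n0 : (0 : R) < n%:R by apply: lt_le_trans n2.
have [Us|/existsNP[x /not_implyP[xs nUx]]] := pselect (all_in (U n) s).
  by apply: (near (rg q k.+1 l gq) n).
have [/hasP[y ys gy]|/hasPn g0] := boolP (has (fun y => g n y != 0) s); last first.
  by rewrite divdiff0 ?(gauge0 gq) ?mulr0 ?ler01// => y /g0 /negPn /eqP.
have xy : n%:R ^- 2 <= `|x - y| by apply: (near gap n).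
have d0 : (0 : R) < n%:R ^- 2 by rewrite invr_gt0 exprn_gt0.
have M s' : subseq s' s -> (size s').+1 = size s -> q' (divdiff (g n) s') <= n%:R ^- (l + 3).
  move=> s's; rewrite ss => -[ss'].
  rewrite -div1r ler_pdivlMr ?exprn_gt0// mulrC.
  by apply: (near (IH q' (l + 3)%N gq') n) => //; exact: subseq_uniq s's us.
have := gauge_divdiff_rec gq qq' gq' us xs ys d0 xy M.
rewrite invrK => qM; apply: (@le_trans _ _ (n%:R ^+ l * (n%:R ^+ 2 * (n%:R ^- (l + 3) *+ 2)))).
  by rewrite ler_pM2l ?exprn_gt0.
have -> : n%:R ^+ l * (n%:R ^+ 2 * (n%:R ^- (l + 3) *+ 2)) = 2 / n%:R :> R.
  by rewrite exprD; field; rewrite !expf_neq0 ?gt_eqF.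
by rewrite ler_pdivrMr// mul1r.
Unshelve. all: by end_near. Qed.

End Rapid.

Lemma moderate_affine (R : realType) (f : R -> R^o) (a b : nat -> R) :
  (forall k, exists M, forall s, uniq s -> size s = k.+1 -> `|divdiff f s : R| <= M) ->
  (\forall n \near \oo, a n != 0 /\ `|a n| <= n%:R ^+ 3) ->
  moderate (fun n t => f (a n * t + b n)).
Proof.
move=> fb an k; have [M hM] := fb k.
exists (3 * k).+1; near=> n => s us ss.
have [a0 a3] : a n != 0 /\ `|a n| <= n%:R ^+ 3 by near: n.
have nM : M <= n%:R by near: n; exact: nbhs_infty_ger.
rewrite divdiff_affine// ss /= normrM normrX exprSr exprM.
apply: ler_pM; rewrite ?exprn_ge0//.
  by apply: lerXn2r; rewrite ?nnegrE ?exprn_ge0.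
apply: le_trans nM; apply: hM; last by rewrite size_map.
by rewrite map_inj_uniq// => t u /addIr /(mulfI a0).
Unshelve. all: by end_near. Qed.

(** * Sets without isolated points *)

Section Accumulating.
Context {R : realType}.

Lemma avoid_seq (a b : R) (s : seq R) : a < b ->
  exists x, [/\ a < x, x < b & x \notin s].
Proof.
elim: s a b => [|y s IH] a b ab.
  by exists ((a + b) / 2); split=> //; lra.
have [yab|yab] := leP y ((a + b) / 2).
  have [|x [ax xb xs]] := IH ((a + b) / 2) b; first by lra.
  exists x; split=> //; first by lra.
  by rewrite inE negb_or xs andbT; apply: contraTneq ax => ->; lra.
have [|x [ax xb xs]] := IH a ((a + b) / 2); first by lra.
exists x; split=> //; first by lra.
by rewrite inE negb_or xs andbT; apply: contraTneq xb => ->; lra.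
Qed.

Lemma accumulating_setT : accumulating [set: R].
Proof.
move=> x d s _ d0; have [|y [xy yd ys]] := @avoid_seq x (x + d) s; first by lra.
by exists y; split=> //; rewrite ltr_norml; lra.
Qed.

End Accumulating.

(** * Decay of the given curves *)

Section Smallness.
Context {R : realType} {E : topologicalLmodType R}.

Lemma calibration_le (qs : nat -> E -> R) n x : is_calibration qs -> qs 0%N x <= qs n x.
Proof.
move=> [gq qD]; elim: n => // n /le_trans; apply.
by have := qD n x 0; rewrite addr0 (gauge0 (gq _)) addr0.
Qed.

(** A calibration is nondecreasing, so decay of the [n]-th gauge of a calibration
    that starts at [q] implies decay of [q] itself. *)
Lemma gauge_sup_rapid (U : nat -> set R) (g : nat -> R -> E) :
  (forall n, (0 < n)%N -> is_smooth (U n) (g n)) ->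
  (forall q : E -> R, is_gauge q ->
       exists qs : nat -> E -> R,
         [/\ is_calibration qs, qs 0%N = q &
             forall k l m : nat,
               (fun n : nat => (n%:R ^+ l)%:E *
                  gauge_sup (qs (n + m)%N) (U n) (g n) k)%E
               @ \oo --> (0 : \bar R)%E]) ->
  rapid U g.
Proof.
move=> gs small q k l gq; have [qs [cq q0 lim]] := small q gq.
have /(lim k l 0%N) : nbhs (0 : \bar R)%E [set x | (x < 1)%E].
  by rewrite /nbhs /= /ereal_nbhs /=; apply: (lt_nbhsl ltr01).
rewrite /= => lim1.
near=> n => s us ss Us.
have n0 : (0 < n)%N by near: n; exact: nbhs_infty_gt.
have : ((n%:R ^+ l)%:E * gauge_sup (qs (n + 0)%N) (U n) (g n) k < 1)%E by near: n.
move=> /ltW; rewrite -lee_fin EFinM; apply: le_trans.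
apply: lee_wpmul2l; first by rewrite lee_fin exprn_ge0.
apply: ereal_sup_ge; exists ((qs (n + 0)%N (iter_diff_quotient (U n) (g n) (seqrow k.+1 s)))%:E).
  exists (seqrow k.+1 s) => //; apply/all_in_rowseq.
  by rewrite seqrowK.
rewrite lee_fin iter_diff_quotient_divdiff ?seqrowK//; last 2 first.
- exact: gs.
- by apply/all_in_rowseq; rewrite seqrowK.
by rewrite -q0; exact: calibration_le.
Unshelve. all: by end_near. Qed.

End Smallness.

(** * Gluing bumps that accumulate at a point *)

Section Gluing.
Context {R : realType} {E : topologicalLmodType R}.

(** Left of [T] only finitely many of the functions are nonzero near a given
    point, and right of [T] all vanish.  Near [T] the limit 0 comes from the
    decay: a tuple of [k + 1] points close to [T] meets at most [k + 1] of the
    intervals, all of large index. *)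
Lemma glue_bumps (a : nat -> R) (T : R) (eta : nat -> R -> E) :
  {homo a : m n / (m <= n)%N >-> m <= n} ->
  (forall n, a n < T) -> (forall x, x < T -> exists N, x < a N) ->
  (forall n t, (0 < n)%N -> eta n t != 0 -> a n < t < a n.+1) ->
  (forall n k, (0 < n)%N -> diag_cvg [set: R] (eta n) k) ->
  rapid (fun=> setT) eta ->
  exists c : R -> E, [/\ forall k, diag_cvg [set: R] c k,
    forall n t, (0 < n)%N -> a n < t < a n.+1 -> c t = eta n t &
    forall t, (forall n, (0 < n)%N -> ~ (a n < t < a n.+1)) -> c t = 0].
Proof.
move=> am aT Ta supp de re.
have uq n m t : a n < t < a n.+1 -> a m < t < a m.+1 -> n = m.
  wlog nm : n m / (n < m)%N => [h|/andP[_ tn] /andP[mt _]].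
    by case: (ltngtP n m) => // nm h1 h2; [exact: h|apply/esym; exact: h].
  by have := lt_le_trans tn (am _ _ nm); rewrite ltNge ltW.
have exi t : exists i, forall n, (0 < n)%N -> a n < t < a n.+1 -> n = i.
  have [[n [n0 nt]]|h] := pselect (exists n, (0 < n)%N /\ a n < t < a n.+1).
    by exists n => m _ mt; exact: uq mt nt.
  by exists 0%N => n n0 nt; exfalso; apply: h; exists n.
have [idx idxP] := choice exi.
pose c t := if (0 < idx t)%N then eta (idx t) t else 0.
have cE n t : (0 < n)%N -> a n < t < a n.+1 -> c t = eta n t.
  by move=> n0 nt; rewrite /c -(idxP t n n0 nt) n0.
have c0 t : (forall n, (0 < n)%N -> ~ (a n < t < a n.+1)) -> c t = 0.
  move=> h; rewrite /c; case: ifP => // i0.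
  by apply/eqP; apply: contraT => /(supp _ _ i0) /(h _ i0).
have csum (ns : seq nat) t : uniq ns -> (forall n, n \in ns -> (0 < n)%N) ->
    (forall n, (0 < n)%N -> a n < t < a n.+1 -> n \in ns) ->
    c t = \sum_(n <- ns) eta n t.
  move=> un n0 h; have [[n [np nt]]|nh] := pselect (exists n, (0 < n)%N /\ a n < t < a n.+1).
    rewrite (cE n)// (bigD1_seq n)//=; last exact: h.
    rewrite big1_seq ?addr0// => m /andP[mn mns].
    apply/eqP; apply: contraTT mn => /(supp _ _ (n0 _ mns)) mt.
    by rewrite negbK (uq _ _ _ mt nt).
  rewrite c0; last by move=> n np nt; apply: nh; exists n.
  rewrite big1_seq// => m /andP[_ mns].
  apply/eqP; apply: contraT => /(supp _ _ (n0 _ mns)) mt.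
  by exfalso; apply: nh; exists m; split=> //; exact: n0.
exists c; split=> // k x _.
have [xT|Tx|xT] := ltgtP x T.
- have [N xN] := Ta x xT.
  have deN n : diag_cvg setT (if (0 < n)%N then eta n else fun=> 0) k.
    by case: ifP => [/de//|_]; exact: diag_cvg_cst.
  have [L hL] := @diag_cvg_sum _ E setT nat [seq n <- iota 0 N | (0 < n)%N]
    (fun n => if (0 < n)%N then eta n else fun=> 0) k deN x I.
  exists L; apply: (divdiff_cvg_local (d := a N - x) _ _ hL); first by lra.
  move=> t _ tx; split=> //.
  rewrite (csum [seq n <- iota 0 N | (0 < n)%N]).
  + by rewrite !big_filter; apply: eq_bigr => n n0; rewrite n0.
  + by rewrite filter_uniq// iota_uniq.
  + by move=> n; rewrite mem_filter => /andP[].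
  + move=> n n0 /andP[nt _]; rewrite mem_filter n0 mem_iota add0n /=.
    rewrite ltnNge; apply/negP => /am Nn.
    by move: tx; rewrite ltr_norml; lra.
- have [L hL] := @diag_cvg_cst _ E setT 0 k x I; exists L.
  apply: (divdiff_cvg_local (d := x - T) _ _ hL); first by lra.
  move=> t _; rewrite ltr_norml => /andP[_ tx]; split=> //; apply: c0 => n _ /andP[_ tn].
  by have := aT n.+1; lra.
exists 0 => W /nbhs0_gauge[q gq qW]; have [q' gq' qq'] := gauge_sum k gq.
(* Beyond the index [M] each of the at most [k + 1] terms is at most [1 / M],
   and [k + 1 < M]. *)
have [N _ hN] := re q' k 1%N gq'; pose M := maxn N k.+2.
have TM : a M < T by [].
exists (T - a M); first by rewrite /= subr_gt0.
move=> s [us _ sx]; suff : W (divdiff c s) by []; apply: qW.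
have ss := tuple_close_size sx; rewrite size_nseq in ss.
have sM t : t \in s -> a M < t.
  move/tuple_close_nseqP : sx => [_ h] /h; rewrite xT ltr_norml; lra.
(* Contains the index of every interval that meets [s]. *)
pose ns := undup [seq n <- [seq idx t | t <- s] | (M <= n)%N].
have nsM n : n \in ns -> (M <= n)%N by rewrite mem_undup mem_filter => /andP[].
have Mp : (k.+2 <= M)%N by exact: leq_maxr.
have -> : divdiff c s = \sum_(n <- ns) divdiff (eta n) s.
  rewrite -divdiff_sum; apply: eq_divdiff => t ts; apply: csum.
  - exact: undup_uniq.
  - by move=> n /nsM; apply: leq_trans; apply: leq_trans Mp.
  - move=> n n0 nt; rewrite mem_undup mem_filter; apply/andP; split.
      rewrite leqNgt; apply/negP => /am nM.
      by have := sM t ts; case/andP: nt; lra.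
    by rewrite (idxP t n n0 nt); apply: map_f.
have szn : (size ns <= k.+1)%N.
  apply: leq_trans (size_undup _) _; rewrite size_filter.
  by apply: leq_trans (count_size _ _) _; rewrite size_map ss.
apply: le_lt_trans (qq' _ _ _ szn) _.
have M0 : (0 : R) < M%:R by rewrite ltr0n; apply: leq_trans Mp.
apply: (@le_lt_trans _ _ (\sum_(n <- ns) M%:R^-1)).
  rewrite big_seq [leRHS]big_seq; apply: ler_sum => n /nsM Mn.
  rewrite -div1r ler_pdivlMr// mulrC.
  apply: (@le_trans _ _ (n%:R ^+ 1 * q' (divdiff (eta n) s))).
    by apply: ler_wpM2r; [case: gq'|rewrite expr1 ler_nat].
  apply: hN => //; exact: leq_trans (leq_maxl _ _) Mn.
rewrite big_const_seq count_predT iter_addr_0 -[ltLHS]mulr_natl ltr_pdivrMr// mul1r ltr_nat.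
by apply: leq_trans Mp; rewrite ltnS.
Qed.

End Gluing.

(** * Cutting off the given curves *)

Lemma norm_gauge (R : realType) : is_gauge (fun x : R^o => `|x : R|).
Proof.
split=> [x|t x|r r0]; first exact: normr_ge0.
  by rewrite normrM.
exists r => // x /=; rewrite sub0r normrN in_itv /= => ->.
by rewrite normr_ge0.
Qed.

(** The width of the region where the [n]-th cutoff descends from 1 to 0.  It is
    at most [n ^ - 2], has a moderate inverse, and its sums telescope. *)
Definition collar (R : realType) (n : nat) : R := (n%:R * n.+1%:R)^-1.

Section Cutoff.
Context {R : realType} {E : topologicalLmodType R}.

Lemma collar_gt0 n : (0 < n)%N -> 0 < collar R n.
Proof. by move=> n0; rewrite invr_gt0 mulr_gt0// ltr0n. Qed.

Lemma collar_le n : (0 < n)%N -> collar R n <= n%:R ^- 2.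
Proof.
move=> n0; rewrite lef_pV2 ?posrE ?mulr_gt0 ?exprn_gt0 ?ltr0n//.
by rewrite expr2 ler_pM2l ?ltr0n// ler_nat.
Qed.

Lemma smooth_diag_cvg (U : set R) (c : R -> E) k : is_smooth U c -> diag_cvg U c k.
Proof.
move=> sc a Ua.
have Ua' : setpow U (const_mx a : 'rV_k.+1) by move=> i; rewrite mxE.
have := iter_diff_quotient_cvg (sc k) Ua'.
have -> : rowseq (const_mx a : 'rV_k.+1) = nseq k.+1 a.
  apply: (@eq_from_nth _ 0); rewrite size_rowseq ?size_nseq// => i ik.
  by rewrite (nth_rowseq _ (Ordinal ik)) mxE nth_nseq ik.
by exists (iter_diff_quotient U c (const_mx a : 'rV_k.+1)).
Qed.

(** [chi n] is a product of two rescaled smooth steps, one for each end.  As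
    [r n] exceeds [s n + collar n] by at least [n ^ - 2], the product with
    [gam n] extends by 0 beyond [- r n] and [r n], with all estimates. *)
Lemma cutoff (s r : nat -> R) (gam : nat -> R -> E) :
  (forall n, (0 < n)%N -> s n + 2 / n%:R ^+ 2 <= r n) ->
  (forall n, (0 < n)%N -> is_smooth `[- r n, r n] (gam n)) ->
  rapid (fun n => `[- r n, r n]%classic) gam ->
  exists chi : nat -> R -> R,
  [/\ forall n t, (0 < n)%N -> `|t| <= s n -> chi n t = 1,
      forall n t, (0 < n)%N -> s n + collar R n <= `|t| -> chi n t = 0,
      forall n t, 0 <= chi n t <= 1,
      forall n k, (0 < n)%N -> diag_cvg setT (fun t => chi n t *: gam n t) k &
      rapid (fun=> setT) (fun n t => chi n t *: gam n t)].
Proof.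
move=> sr sm ra.
have [f [df f0 f1 f01]] := @smooth_step R.
have fb k : exists M, forall s', uniq s' -> size s' = k.+1 -> `|divdiff f s' : R| <= M.
  exact: (gauge_divdiff_bounded k (norm_gauge R) df f0 f1).
(* The two arguments of [f] are [(s n + collar n + t) / collar n] and the same
   with [- t]: they are at least 1 when [t] is in [[- s n, s n]], and one of
   them is at most 0 beyond [s n + collar n]. *)
pose v (n : nat) : R := n%:R * n.+1%:R; pose b n := 1 + v n * s n.
have v0 n : (0 < n)%N -> 0 < v n by move=> n0; rewrite mulr_gt0// ltr0n.
have vw n : (0 < n)%N -> v n * collar R n = 1.
  by move=> n0; rewrite mulfV// gt_eqF// v0.
pose h1 n (t : R) : R^o := f (v n * t + b n).
pose h2 n (t : R) : R^o := f (- v n * t + b n).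
have vn : \forall n \near \oo, v n != 0 /\ `|v n| <= n%:R ^+ 3.
  near=> n.
  have n2 : (2 <= n)%N by near: n; exact: nbhs_infty_ge.
  have n0 : (0 < n)%N by apply: leq_trans n2.
  split; first by rewrite gt_eqF// v0.
  rewrite gtr0_norm ?v0// exprS ler_pM2l ?ltr0n// -natrX ler_nat.
  by rewrite -mulnn; apply: leq_trans (leq_mul n2 (leqnn n)); rewrite mul2n -addnn -addn1 leq_add2l.
have m1 : moderate h1 by exact: moderate_affine.
have m2 : moderate h2.
  apply: moderate_affine => //; near=> n; rewrite oppr_eq0 normrN.
  by near: n.
have chi1 n t : (0 < n)%N -> `|t| <= s n -> h1 n t = 1 /\ h2 n t = 1.
  move=> n0; rewrite ler_norml => /andP[ts st]; have := v0 n n0 => vp.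
  split; apply: f1; rewrite /b.
    have := ler_wpM2l (ltW vp) ts; rewrite mulrN; lra.
  by have := ler_wpM2l (ltW vp) st; lra.
have chi0 n t : (0 < n)%N -> s n + collar R n <= `|t| -> h1 n t = 0 \/ h2 n t = 0.
  move=> n0 st; have vp := v0 n n0; have := ler_wpM2l (ltW vp) st.
  rewrite mulrDr vw//; have [tp|tn] := leP 0 t.
    by rewrite ger0_norm// => h; right; apply: f0; rewrite /b; lra.
  by rewrite ltr0_norm// mulrN => h; left; apply: f0; rewrite /b; lra.
have E0 n t : (0 < n)%N -> s n + collar R n <= `|t| -> (h1 n t : R) * (h2 n t : R) = 0.
  by move=> n0 /(chi0 _ _ n0)[->|->]; rewrite ?mul0r ?mulr0.
have wr n : (0 < n)%N -> s n + collar R n + n%:R ^- 2 <= r n.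
  move=> n0; apply: le_trans (sr n n0); have := collar_le n0; lra.
exists (fun n t => (h1 n t : R) * (h2 n t : R)); split.
- by move=> n t n0 /(chi1 _ _ n0)[-> ->]; rewrite mulr1.
- exact: E0.
- move=> n t; have /andP[a1 b1] := f01 (v n * t + b n).
  have /andP[a2 b2] := f01 (- v n * t + b n).
  by rewrite mulr_ge0//= mulr_ile1.
- move=> n k n0 a _.
  have np : 0 < n%:R ^- 2 :> R by rewrite invr_gt0 exprn_gt0// ltr0n.
  have [ar|ra'] := ltP `|a| (r n).
    have dU : diag_cvg `[- r n, r n] (fun t => h1 n t *: (h2 n t *: gam n t)) k.
      have dh (u z : R) j : u != 0 -> diag_cvg `[- r n, r n] (fun t => f (u * t + z)) j.
        by move=> u0; apply: (@diag_cvg_sub _ R^o setT) => //; exact: diag_cvg_affine.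
      have vn0 : v n != 0 by rewrite gt_eqF// v0.
      apply: diag_cvg_mul => j _; first exact: dh.
      apply: diag_cvg_mul => i _; first by apply: dh; rewrite oppr_eq0.
      exact: smooth_diag_cvg (sm n n0).
    have [|L hL] := dU a; first by rewrite /= in_itv /= -ler_norml ltW.
    exists L; apply: (divdiff_cvg_local (d := r n - `|a|) _ _ hL); first by rewrite subr_gt0.
    move=> t _ ta; split; last by rewrite scalerA.
    rewrite /= in_itv /= -ler_norml; rewrite distrC in ta.
    by have := ler_distD a t 0; rewrite !subr0; lra.
  have [L hL] := @diag_cvg_cst _ E setT 0 k a I.
  exists L; apply: (divdiff_cvg_local (d := n%:R ^- 2) _ _ hL) => // t _ ta; split=> //.
  rewrite E0 ?scale0r//.
  have := ler_distD t a 0; rewrite !subr0; have := wr n n0; lra.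
have re : rapid (fun n => `[- r n, r n]%classic) (fun n t => h1 n t *: (h2 n t *: gam n t)).
  by apply: rapid_mul => //; exact: rapid_mul.
have -> : (fun n t => ((h1 n t : R) * (h2 n t : R)) *: gam n t) =
    (fun n t => h1 n t *: (h2 n t *: gam n t)).
  by apply/funext => n; apply/funext => t; rewrite scalerA.
apply: rapid_extend re _; near=> n => x y xr gy.
have n0 : (0 < n)%N by near: n; exact: nbhs_infty_gt.
have yl : `|y| < s n + collar R n.
  by rewrite ltNge; apply: contraNN gy => /(E0 _ _ n0); rewrite scalerA => ->; rewrite scale0r.
have xl : r n < `|x|.
  by rewrite ltNge; apply/negP => xl; apply: xr; rewrite /= in_itv /= -ler_norml.
have := ler_distD y x 0; rewrite !subr0; have := wr n n0; lra.
Unshelve. all: by end_near. Qed.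

End Cutoff.

(** * Placing the intervals *)

Section Placement.
Context {R : realType}.

Lemma collar_sum n : \sum_(1 <= i < n.+1) collar R i = 1 - n.+1%:R^-1.
Proof.
elim: n => [|n IH]; first by rewrite big_geq// invr1 subrr.
rewrite big_nat_recr//= IH /collar.
have n1 : n.+1%:R != 0 :> R by rewrite pnatr_eq0.
have n2 : n.+2%:R != 0 :> R by rewrite pnatr_eq0.
have e : n.+2%:R = n.+1%:R + 1 :> R by rewrite -addn1 natrD.
move: n1 n2; rewrite e; move: (n.+1%:R : R) => x x0 x1.
by field; rewrite x0 x1.
Qed.

(** [a n] is the left end of the [n]-th interval and [T] the supremum of the
    ends; it is finite since the [s n] and the collars are summable. *)
Lemma placement (s : nat -> R) : (forall n, (0 < n)%N -> 0 < s n) ->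
  (\sum_(1 <= n <oo) (s n)%:E < +oo)%E ->
  exists (a : nat -> R) (T : R),
  [/\ {homo a : m n / (m <= n)%N >-> m <= n}, a @ \oo --> T, forall n, 0 <= a n < T,
      forall x, x < T -> exists N, x < a N &
      forall n, (0 < n)%N -> a n.+1 = a n + (s n + collar R n) *+ 2].
Proof.
move=> s0 ssum; pose u n := (s n + collar R n) *+ 2.
have u0 n : (0 < n)%N -> 0 < u n.
  by move=> n0; rewrite mulrn_wgt0// addr_gt0 ?s0// collar_gt0.
pose a n := \sum_(1 <= i < n) u i.
have aS n : (0 < n)%N -> a n.+1 = a n + u n by move=> n0; rewrite /a big_nat_recr.
have am : {homo a : m n / (m <= n)%N >-> m <= n}.
  apply: homo_leq; [exact: lexx|exact: le_trans|] => -[|n].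
    by rewrite /a !big_geq.
  by rewrite (aS n.+1)// lerDl ltW// u0.
pose S : R := fine (\sum_(1 <= n <oo) (s n)%:E)%E.
have sS n : \sum_(1 <= i < n) s i <= S.
  have h := @nneseries_lim_ge R (fun i => (s i)%:E) xpredT 1 n.
  rewrite -lee_fin fineK; last first.
    rewrite ge0_fin_numE//; apply: nneseries_ge0 => i i1 _.
    by rewrite lee_fin ltW// s0.
  rewrite -sumEFin; apply: h => i i1 _; by rewrite lee_fin ltW// s0.
have aub n : a n <= (S + 1) *+ 2.
  rewrite /a /u sumrMnl lerMn2r /= big_split /=.
  apply: lerD => //; case: n => [|n]; first by rewrite big_geq.
  by rewrite collar_sum gerDl oppr_le0 invr_ge0.
have hub : has_ubound (range a) by exists ((S + 1) *+ 2) => _ [n _ <-].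
have hs : has_sup (range a) by split=> //; exists (a 0%N), 0%N.
exists a, (sup (range a)); split=> //.
- exact: nondecreasing_cvgn.
- move=> n; apply/andP; split.
    by have := am _ _ (leq0n n); rewrite {1}/a big_geq.
  apply: (@lt_le_trans _ _ (a n.+2)).
    by apply: (@le_lt_trans _ _ (a n.+1)); [exact: am|rewrite (aS n.+1)// ltrDl u0].
  by apply: ub_le_sup => //; exists n.+2.
- move=> x /(sup_gt hs.1)[_ [N _ <-] xN]; by exists N.
Qed.

End Placement.

(* Sequences indexed by {1, 2, ...} are functions on nat whose value at 0 is
   ignored. *)
Theorem theorem4p1 (R : realType) (E : topologicalLmodType R)
    (hE : hausdorff_space E) (s r : nat -> R)
    (s_gt0 : forall n, (0 < n)%N -> 0 < s n)
    (r_gt0 : forall n, (0 < n)%N -> 0 < r n)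
    (s_summable : (\sum_(1 <= n <oo) (s n)%:E < +oo)%E)
    (r_ge : forall n, (0 < n)%N -> s n + 2 / n%:R ^+ 2 <= r n)
    (gam : nat -> R -> E)
    (gam_smooth : forall n, (0 < n)%N -> is_smooth `[- r n, r n] (gam n))
    (gam_small : forall q : E -> R, is_gauge q ->
       exists qs : nat -> E -> R,
         [/\ is_calibration qs, qs 0%N = q &
             forall k l m : nat,
               (fun n : nat => (n%:R ^+ l)%:E *
                  gauge_sup (qs (n + m)%N) `[(- r n)%R, r n] (gam n) k)%E
               @ \oo --> (0 : \bar R)%E]) :
  exists c : R -> E,
    [/\ is_BCinfty [set: R] c,
        range c `<=`
          [set t *: x | t in `[0, 1] &
             x in \bigcup_(n in [set n | (0 < n)%N]) (gam n @` `[- r n, r n])] &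
        exists t : nat -> R,
          cvg (t @ \oo) /\
          forall n, (0 < n)%N ->
            forall u, u \in `[- s n, s n] -> c (t n + u) = gam n u].
Proof.
have rg : rapid (fun n => `[- r n, r n]%classic) gam by exact: gauge_sup_rapid.
have [chi [chi1 chi0 chi01 dchi rchi]] := cutoff r_ge gam_smooth rg.
have [a [T [am aT a0T Ta aS]]] := placement s_gt0 s_summable.
have a0 n : 0 <= a n by case/andP: (a0T n).
have aTlt n : a n < T by case/andP: (a0T n).
pose t n := (a n + a n.+1) / 2.
pose H n (u : R) := chi n u *: gam n u.
pose eta n (u : R) := H n (1 * u + - t n).
have tE n : (0 < n)%N -> a n = t n - (s n + collar R n) /\
    a n.+1 = t n + (s n + collar R n).
  by move=> n0; rewrite /t aS//; split; lra.
have supp n u : (0 < n)%N -> eta n u != 0 -> a n < u < a n.+1.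
  move=> n0; apply: contraNT => nu; rewrite /eta /H chi0 ?scale0r//.
  have [e1 e2] := tE n n0; rewrite leNgt; apply: contra nu.
  by rewrite ltr_norml e1 e2; lra.
have deta n k : (0 < n)%N -> diag_cvg [set: R] (eta n) k.
  by move=> n0; apply: diag_cvg_affine; [exact: oner_neq0|exact: dchi].
have reta : rapid (fun=> setT) eta.
  move=> q k l gq; near=> n => s' us ss _.
  rewrite /eta divdiff_affine ?oner_eq0// expr1n scale1r.
  apply: (near (rchi q k l gq) n) => //; last by rewrite size_map.
  by rewrite map_inj_uniq// => x y /addIr; rewrite !mul1r.
have [c [dc cE c0]] := glue_bumps am aTlt Ta supp deta reta.
exists c; split.
- apply: (@BCinfty_diag _ _ c 0 T) => //; first exact: accumulating_setT.
  + move=> u u0; apply: c0 => n _ /andP[nu _].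
    by have := a0 n; lra.
  + move=> u Tu; apply: c0 => n _ /andP[_ un].
    by have := aTlt n.+1; lra.
- move=> _ [u _ <-].
  have [[n [n0 nu]]|h] := pselect (exists n, (0 < n)%N /\ a n < u < a n.+1).
    rewrite (cE n)// /eta /H.
    exists (chi n (1 * u + - t n)); first by rewrite /= in_itv /=.
    exists (gam n (1 * u + - t n)) => //; exists n => //; exists (1 * u + - t n) => //.
    have [e1 e2] := tE n n0; have := r_ge n n0; have := collar_le n0 (R := R).
    have : (0 : R) < n%:R ^- 2 by rewrite invr_gt0 exprn_gt0// ltr0n.
    by move: nu; rewrite e1 e2 /= in_itv /= mul1r; lra.
  rewrite c0; last by move=> n n0 nu; apply: h; exists n.
  exists 0; first by rewrite /= in_itv /= lexx ler01.
  exists (gam 1%N 0); last by rewrite scale0r.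
  exists 1%N => //; exists 0 => //.
  by rewrite /= in_itv /= oppr_le0 ltW ?r_gt0.
- exists t; split.
    have : (fun n => (a n + a n.+1) / 2) @ \oo --> (T + T) / 2.
      apply: cvgM; last exact: cvg_cst.
      by apply: cvgD => //; rewrite cvg_shiftS.
    by move=> h; apply/cvg_ex; exists ((T + T) / 2).
  move=> n n0 u; rewrite in_itv /= => /andP[us su].
  have [e1 e2] := tE n n0; have w0 := collar_gt0 n0 (R := R).
  rewrite (cE n)//; last by rewrite e1 e2; have := s_gt0 n n0; lra.
  rewrite /eta /H; have -> : 1 * (t n + u) + - t n = u by ring.
  by rewrite chi1 ?scale1r// ler_norml us su.
Unshelve. all: by end_near. Qed.
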